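(* Let $w$ be a weight on the unit disc $\mathbb{D}$ which is radial and satisfies $0<w(0)<\infty$. Consider the conditions: (a) $w\in B_p$ for some $1<p<\infty$; (b) $w$ has the reverse Hölder property; (c) $w$ has the reverse Jensen property; (d) $w\in B_\infty$. Suppose that either $w$ is increasing and satisfies at least one of (a), (b), (c), (d), or $w$ is decreasing and satisfies at least one of (a), (b), (c). Then $w$ is almost constant on top halves.
   Context: $\mathbb{D}=\{z\in\mathbb{C}:|z|<1\}$ carries normalized area measure and $\mathbb{T}=\{|z|=1\}$ carries normalized arc length measure; $|\cdot|$ denotes these measures. $I\subset\mathbb{T}$ always means that $I$ is an interval (arc) of $\mathbb{T}$ of positive length, possibly all of $\mathbb{T}$. The Carleson square of $I$ is $Q_I=\{z\in\mathbb{D}\setminus\{0\}: z/|z|\in I,\ 1-|z|<|I|\}$ and its top half is $T_I=\{z\in\mathbb{D}\setminus\{0\}: z/|z|\in I,\ |I|/2<1-|z|<|I|\}$. For measurable $f$ on $\mathbb{D}$, $Mf(z)=\sup_{I\subset\mathbb{T}:\,z\in Q_I}\frac{1}{|Q_I|}\int_{Q_I}|f|$. A weight on $\mathbb{D}$ is a measurable $w:\mathbb{D}\to[0,\infty]$ with $0<w<\infty$ a.e. For an integrable weight $w$ (the classes below consist of integrable weights only): - $w\in B_p$ ($1<p<\infty$) if there is $C>0$ with $\left(\frac1{|Q_I|}\int_{Q_I}w\right)\left(\frac1{|Q_I|}\int_{Q_I}w^{1-p'}\right)^{p-1}\le C$ for all $I\subset\mathbb{T}$, where $p'=p/(p-1)$.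 - $w$ has the reverse Jensen property if there is $C>0$ with $\frac1{|Q_I|}\int_{Q_I}w\le C\exp\left(\frac1{|Q_I|}\int_{Q_I}\log w\right)$ for all $I\subset\mathbb{T}$. - $w$ has the reverse Hölder property if there are $1<q<\infty$ and $C>0$ with $\left(\frac1{|Q_I|}\int_{Q_I}w^q\right)^{1/q}\le\frac{C}{|Q_I|}\int_{Q_I}w$ for all $I\subset\mathbb{T}$. - $w\in B_\infty$ if there is $C>0$ with $\int_{Q_I}M(w1_{Q_I})\le C\int_{Q_I}w$ for all $I\subset\mathbb{T}$. A weight $w$ is almost constant on top halves if there is $C\ge1$ with $\operatorname{ess\,sup}_{T_I}w\le C\operatorname{ess\,inf}_{T_I}w$ for all $I\subset\mathbb{T}$. A weight $w$ is radial if $w(z)=f(|z|)$ for all $z\in\mathbb{D}$ for some measurable $f:[0,1)\to[0,\infty]$; it is then increasing (resp. decreasing) if $f$ is increasing (resp. decreasing), in the weak (non-strict) sense. *)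

(* Defs.v *)
From HB Require Import structures.
From mathcomp Require Import all_boot all_order all_algebra.
From mathcomp Require Import all_classical all_reals all_analysis.
From mathcomp Require Import measurable_realfun ess_sup_inf.

Set Implicit Arguments.
Unset Strict Implicit.
Unset Printing Implicit Defensive.

Import Order.TTheory GRing.Theory Num.Theory.
Import numFieldNormedType.Exports.

Local Open Scope classical_set_scope.
Local Open Scope ring_scope.

(* The complex plane is identified with R * R, z = (x, y) standing for x + iy. *)
Notation plane R := (measurableTypeR R * measurableTypeR R)%type.

(* Not the library norm of R * R, which is the sup norm. *)
Definition cmod (R : realType) (z : plane R) : R :=
  Num.sqrt (z.1 ^+ 2 + z.2 ^+ 2).

(* z / |z| *)
Definition cdir (R : realType) (z : plane R) : plane R :=
  (z.1 / cmod z, z.2 / cmod z).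

(* e^(it) *)
Definition cis (R : realType) (t : R) : plane R := (cos t, sin t).

Definition disc (R : realType) : set (plane R) := [set z | cmod z < 1].
Arguments disc R _ : clear implicits.

Lemma pi_inv_ge0 (R : realType) : 0 <= (pi : R)^-1.
Proof. by rewrite invr_ge0 pi_ge0. Qed.

(* Lebesgue measure on the plane divided by pi, so that the disc has measure 1. *)
Definition area (R : realType) : {measure set (plane R) -> \bar R} :=
  mscale (NngNum (@pi_inv_ge0 R))
    (product_measure1 (@lebesgue_measure R) (@lebesgue_measure R)).

Local Open Scope ereal_scope.

(* Normalized arc length of a subset of the unit circle. *)
Definition arclen (R : realType) (I : set (plane R)) : \bar R :=
  ((2 * pi)^-1)%:E *
  lebesgue_measure ([set t : R | (0 <= t < 2 * pi)%R /\ I (cis t)]).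

(* J may be open, closed or half-open, and may be longer than 2 pi,
   in which case I is the whole circle. *)
Definition is_arc (R : realType) (I : set (plane R)) : Prop :=
  (exists2 J : set R, is_interval J & I = @cis R @` J) /\ 0 < arclen I.

Definition carleson (R : realType) (I : set (plane R)) : set (plane R) :=
  [set z | [/\ (cmod z < 1)%R, z <> (0%R, 0%R), I (cdir z) &
            (1 - cmod z)%:E < arclen I]].

Definition tophalf (R : realType) (I : set (plane R)) : set (plane R) :=
  [set z | [/\ (cmod z < 1)%R, z <> (0%R, 0%R), I (cdir z),
            (2^-1)%:E * arclen I < (1 - cmod z)%:E &
            (1 - cmod z)%:E < arclen I]].

(* Mean value; only used for sets A with 0 < |A| < +oo. *)
Definition avg (R : realType) (A : set (plane R)) (f : plane R -> \bar R) :
    \bar R :=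
  ((fine (area R A))^-1)%:E * \int[area R]_(z in A) f z.

(* At points lying in no Carleson square (such as the origin) the supremum of
   the empty set is -oo here; these points are never integrated over below. *)
Definition maxfun (R : realType) (f : plane R -> \bar R) (z : plane R) :
    \bar R :=
  ereal_sup [set a | exists I : set (plane R),
    [/\ is_arc I, carleson I z & a = avg (carleson I) (fun u => `|f u|)]].

(* Only the values of w on the disc are relevant. Measurability is Borel
   measurability, which is automatic for a radial w with monotone profile. *)
Definition weight (R : realType) (w : plane R -> \bar R) : Prop :=
  [/\ measurable_fun (disc R) w,
      (forall z, disc R z -> 0 <= w z) &
      {ae area R, forall z, disc R z -> 0 < w z < +oo}].

(* The values of poweR with a negative exponent at 0 and +oo are not the usual
   ones; a weight takes these values on a null set only. *)
Definition Bp (R : realType) (p : R) (w : plane R -> \bar R) : Prop :=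
  (area R).-integrable (disc R) w /\
  exists C : R, (0 < C)%R /\ forall I, is_arc I ->
    avg (carleson I) w *
    (avg (carleson I) (fun z => w z `^ (1 - p / (p - 1))%R)) `^ (p - 1)%R
    <= C%:E.

Definition reverse_Jensen (R : realType) (w : plane R -> \bar R) : Prop :=
  (area R).-integrable (disc R) w /\
  exists C : R, (0 < C)%R /\ forall I, is_arc I ->
    avg (carleson I) w <= C%:E * expeR (avg (carleson I) (fun z => lne (w z))).

Definition reverse_Hoelder (R : realType) (w : plane R -> \bar R) : Prop :=
  (area R).-integrable (disc R) w /\
  exists q C : R, [/\ (1 < q)%R, (0 < C)%R & forall I, is_arc I ->
    (avg (carleson I) (fun z => w z `^ q)) `^ q^-1
    <= C%:E * avg (carleson I) w].

Definition Binfty (R : realType) (w : plane R -> \bar R) : Prop :=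
  (area R).-integrable (disc R) w /\
  exists C : R, (0 < C)%R /\ forall I, is_arc I ->
    \int[area R]_(z in carleson I) maxfun (w \_ (carleson I)) z
    <= C%:E * \int[area R]_(z in carleson I) w z.

(* Essential bounds over A: outside A the function is replaced by the neutral
   value -oo (resp. +oo). *)
Definition ess_sup_on (R : realType) (A : set (plane R))
    (f : plane R -> \bar R) : \bar R := ess_sup (area R) (patch (cst -oo) A f).

Definition ess_inf_on (R : realType) (A : set (plane R))
    (f : plane R -> \bar R) : \bar R := ess_inf (area R) (patch (cst +oo) A f).

Definition almost_constant (R : realType) (w : plane R -> \bar R) : Prop :=
  exists C : R, (1 <= C)%R /\ forall I, is_arc I ->
    ess_sup_on (tophalf I) w <= C%:E * ess_inf_on (tophalf I) w.

Definition radial_profile (R : realType) (w : plane R -> \bar R)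
    (f : R -> \bar R) : Prop :=
  [/\ measurable_fun (`[0%R, 1%R[ : set R) f,
      (forall r : R, (0 <= r < 1)%R -> 0 <= f r) &
      forall z, disc R z -> w z = f (cmod z)].

Definition radial (R : realType) (w : plane R -> \bar R) : Prop :=
  exists f, radial_profile w f.

Definition radial_increasing (R : realType) (w : plane R -> \bar R) : Prop :=
  exists f, radial_profile w f /\
    forall r s : R, (0 <= r)%R -> (r <= s)%R -> (s < 1)%R -> f r <= f s.

Definition radial_decreasing (R : realType) (w : plane R -> \bar R) : Prop :=
  exists f, radial_profile w f /\
    forall r s : R, (0 <= r)%R -> (r <= s)%R -> (s < 1)%R -> f s <= f r.

(* Main.v *)
Require Import Defs.
From HB Require Import structures.
From mathcomp Require Import all_boot all_order all_algebra.
From mathcomp Require Import all_classical all_reals all_analysis.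
From mathcomp Require Import measurable_realfun ess_sup_inf.
From mathcomp Require Import ring lra.

(** Write w(z) = v(|z|) with v monotone. Being almost constant on top halves
    then means that v(1 - h) and v(1 - h / 2) are comparable, uniformly in
    0 < h <= 1. For h bounded away from 0 this is monotonicity together with
    0 < w(0) < +oo, so only small h matter, and for these it suffices to test
    the hypothesis on Carleson squares of the arcs {e^(it) : a <= t < a + s}
    inside the upper half circle.

    Each of the conditions B_p, reverse Hölder and reverse Jensen prevents w
    from being small on most of a Carleson square Q and large on a fixed
    proportion of it. This common consequence is [level_control]: for some
    lam > 0 and every b > 0, if w <= m on a part S of Q with
    |S| >= (1 - lam) |Q| and w >= M on a part B with |B| >= b |Q|, then
    M <= C m. For B_p both means are bounded below by these data. For reverse
    Jensen and reverse Hölder one integrates a pointwise inequality, the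
    tangent line of log at the mean of w, respectively
    w <= m + T 1_(Q \ S) + T^(1 - r) w^r, which takes the place of Hölder's
    inequality. Applied to S and B bounded by circles around the origin, this
    is a doubling property of v. If v increases, w is large near the unit
    circle, so Q is taken of side N h with N = 2 / lam, B is the strip
    |z| > 1 - h / 2 and S is the part |z| < 1 - h, which fills most of Q. If v
    decreases, w is large on the side of Q away from the circle, where only a
    thin layer may be left out of S: this compares v at heights h and rho h,
    the height of z being 1 - |z|, with rho < 1 possibly close to 1, and
    iterating gives the factor 1 / 2.

    For B_infinity and v increasing, take a square Q of side 2^n h and let V be
    the mass of w on the part |z| > 1 - h of a square of side h. A point of Q
    at height between 2^k h and 2^(k+1) h lies in a square of side 2^(k+1) h
    contained in Q, which carries mass at least 2^(k+1) V; so each of the n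
    layers contributes at least 2^n V / 4 to the integral of the maximal
    function over Q. As the integral of w over Q is at most
    2^n V + v(1 - h) |Q|, for n large compared with the constant the term
    2^n V can be absorbed, and V is bounded by a multiple of v(1 - h) times the
    area of a square of side h.

    The areas needed come without polar coordinates. Dilations give the area of
    a sector cut by two circles up to the factor [wedge]. Rotations are products
    of three shears, hence preserve area, and cutting an arc into two halves of
    equal length then gives the integral of a radial function over sectors of
    dyadically related angles. *)

Set Implicit Arguments.
Unset Strict Implicit.
Unset Printing Implicit Defensive.

Import Order.TTheory GRing.Theory Num.Theory.
Import numFieldNormedType.Exports.

Local Open Scope classical_set_scope.
Local Open Scope ring_scope.

(** * Shears, rotations and dilations of the plane *)

Section lebesgue_affine.
Context {R : realType}.
Local Notation mR := (measurableTypeR R).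
Local Notation mu := (@lebesgue_measure R).

Lemma lebesgue_measure_translate (c : R) (A : set mR) : measurable A ->
  mu ((fun x => x + c) @^-1` A) = mu A.
Proof.
have mf : measurable_fun setT ((fun x => x + c) : mR -> mR).
  by apply: measurable_funD => //; exact: measurable_cst.
pose f : {mfun mR >-> mR} := HB.pack ((fun x => x + c) : mR -> mR)
  (isMeasurableFun.Build _ _ _ _ _ mf).
move=> mA; apply/esym.
apply: (@lebesgue_measure_unique _ (pushforward mu f)) => //= _ [[a b]] _ <-.
rewrite /pushforward.
have -> : (f @^-1` `]a, b]) = `]a - c, b - c]%classic.
  by apply/seteqP; split => x /=; rewrite !in_itv/= ltrBlDr lerBrDr.
by rewrite !lebesgue_measure_itv/= !lte_fin ltrD2r; case: ifP => // _;
  rewrite -!EFinB; congr EFin; ring.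
Qed.

Lemma lebesgue_measure_dilate (c : R) (A : set mR) : 0 < c -> measurable A ->
  (c%:E * mu ((fun x => c * x)%R @^-1` A) = mu A)%E.
Proof.
move=> c0.
have mf : measurable_fun setT ((fun x => c * x) : mR -> mR).
  by apply: measurable_funM => //; exact: measurable_cst.
pose f : {mfun mR >-> mR} := HB.pack ((fun x => c * x) : mR -> mR)
  (isMeasurableFun.Build _ _ _ _ _ mf).
move=> mA; apply/esym.
apply: (@lebesgue_measure_unique _
  (mscale (NngNum (ltW c0)) (pushforward mu f))) => //= _ [[a b]] _ <-.
rewrite /mscale/= /pushforward.
have -> : (f @^-1` `]a, b]) = `]a / c, b / c]%classic.
  apply/seteqP; split => x /=; rewrite !in_itv/=.
    by rewrite ltr_pdivrMr// ler_pdivlMr// mulrC.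
  by rewrite ltr_pdivrMr// ler_pdivlMr// mulrC.
rewrite !lebesgue_measure_itv/= !lte_fin ltr_pM2r ?invr_gt0//; case: ifP => _.
  by rewrite -!EFinB -EFinM; congr EFin; rewrite -mulrBl mulrC divfK// gt_eqF.
by rewrite mule0.
Qed.

End lebesgue_affine.

Definition hshear {R : realType} (a : R) (z : plane R) : plane R :=
  (z.1 + a * z.2, z.2).
Definition vshear {R : realType} (b : R) (z : plane R) : plane R :=
  (z.1, z.2 + b * z.1).
Definition dilate {R : realType} (c : R) (z : plane R) : plane R :=
  (c * z.1, c * z.2).
Definition rot {R : realType} (a : R) (z : plane R) : plane R :=
  (z.1 * cos a - z.2 * sin a, z.1 * sin a + z.2 * cos a).

Section area_invariance.
Context {R : realType}.
Local Notation mu := (@lebesgue_measure R).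
Local Notation mu2 := (product_measure1 mu mu).

Let measurable_fst_plane : measurable_fun setT (fst : plane R -> measurableTypeR R).
Proof. exact: measurable_fst. Qed.

Let measurable_snd_plane : measurable_fun setT (snd : plane R -> measurableTypeR R).
Proof. exact: measurable_snd. Qed.

Lemma measurable_hshear a : measurable_fun setT (@hshear R a).
Proof.
apply/measurable_fun_pair => //; apply: measurable_funD => //.
by apply: measurable_funM => //; exact: measurable_cst.
Qed.

Lemma measurable_vshear a : measurable_fun setT (@vshear R a).
Proof.
apply/measurable_fun_pair => //; apply: measurable_funD => //.
by apply: measurable_funM => //; exact: measurable_cst.
Qed.

Lemma measurable_dilate a : measurable_fun setT (@dilate R a).
Proof.
by apply/measurable_fun_pair; apply: measurable_funM => //; exact: measurable_cst.
Qed.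

Lemma measurable_rot a : measurable_fun setT (@rot R a).
Proof.
apply/measurable_fun_pair.
  by apply: measurable_funB; apply: measurable_funM => //; exact: measurable_cst.
by apply: measurable_funD; apply: measurable_funM => //; exact: measurable_cst.
Qed.

Lemma measurable_preimageT (f : plane R -> plane R) (A : set (plane R)) :
  measurable_fun setT f -> measurable A -> measurable (f @^-1` A).
Proof. by move=> mf mA; rewrite -[_ @^-1` _]setTI; exact: mf. Qed.

(** By Fubini, as a vertical shear translates each vertical section. *)
Lemma area_vshear b (A : set (plane R)) : measurable A ->
  area R (vshear b @^-1` A) = area R A.
Proof.
move=> mA; rewrite /area /mscale/=; congr (_ * _)%E.
rewrite /product_measure1; apply: eq_integral => x _ /=.
rewrite -[RHS](lebesgue_measure_translate (b * x)); last exact: measurable_xsection.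
by congr (lebesgue_measure _); apply/seteqP; split => y /=; rewrite /xsection/= !inE.
Qed.

(** The same along horizontal sections, Lebesgue measure of the plane being
    also the product measure integrated in the other order. *)
Lemma area_hshear a (A : set (plane R)) : measurable A ->
  area R (hshear a @^-1` A) = area R A.
Proof.
move=> mA; rewrite /area /mscale/=; congr (_ * _)%E.
have swap (X : set (plane R)) : measurable X ->
    mu2 X = product_measure2 mu mu X.
  apply: product_measure_unique => B C mB mC; exact: product_measure2E.
transitivity (product_measure2 mu mu (hshear a @^-1` A)).
  by apply: swap; apply: measurable_preimageT => //; exact: measurable_hshear.
transitivity (product_measure2 mu mu A); last exact/esym/swap.
rewrite /product_measure2; apply: eq_integral => y _ /=.
rewrite -[RHS](lebesgue_measure_translate (a * y)); last exact: measurable_ysection.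
by congr (lebesgue_measure _); apply/seteqP; split => x /=; rewrite /ysection/= !inE.
Qed.

(** With tau = tan (a / 2) this is the matrix identity
    [[1, -tau], [0, 1]] [[1, 0], [sin a, 1]] [[1, -tau], [0, 1]]
    = [[cos a, - sin a], [sin a, cos a]]. *)
Lemma rot_shears (a : R) (z : plane R) : cos (a / 2) != 0 ->
  rot a z = hshear (- tan (a / 2)) (vshear (sin a) (hshear (- tan (a / 2)) z)).
Proof.
case: z => x y ca; rewrite /rot /hshear /vshear/=.
have ea : a = a / 2 + a / 2 by field.
have -> : sin a = sin (a / 2) * cos (a / 2) + cos (a / 2) * sin (a / 2).
  by rewrite -sinD -ea.
have -> : cos a = cos (a / 2) * cos (a / 2) - sin (a / 2) * sin (a / 2).
  by rewrite -cosD -ea.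
rewrite /tan; set c := cos _ in ca *; set s := sin _.
have e : s * s = 1 - c * c.
  by rewrite -[1](cos2Dsin2 (a / 2)) -/c -/s; ring.
by rewrite e; congr pair; field: e.
Qed.

Lemma area_rot a (A : set (plane R)) : - pi < a < pi -> measurable A ->
  area R (rot a @^-1` A) = area R A.
Proof.
move=> /andP[a1 a2] mA.
have ca : cos (a / 2) != 0.
  rewrite gt_eqF// cos_gt0_pihalf// -mulNr ltr_pM2r ?invr_gt0// a1/=.
  by rewrite ltr_pM2r ?invr_gt0.
have mS t B : measurable B -> measurable (@hshear R t @^-1` B).
  by move=> mB; apply: measurable_preimageT => //; exact: measurable_hshear.
have mT t B : measurable B -> measurable (@vshear R t @^-1` B).
  by move=> mB; apply: measurable_preimageT => //; exact: measurable_vshear.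
rewrite -[RHS](area_hshear (- tan (a / 2)))// -[RHS](area_vshear (sin a)); last exact: mS.
rewrite -[RHS](area_hshear (- tan (a / 2))); last by apply: mT; exact: mS.
by congr (area R _); apply/seteqP; split => z /=; rewrite rot_shears.
Qed.

(** Both sides are measures in [A] that agree on rectangles. *)
Lemma area_dilate c (A : set (plane R)) : 0 < c -> measurable A ->
  (area R A = (c ^+ 2)%:E * area R (dilate c @^-1` A))%E.
Proof.
move=> c0 mA; rewrite /area /mscale/= muleCA; congr (_ * _)%E.
have c20 : 0 <= c ^+ 2 by rewrite sqr_ge0.
pose f : {mfun plane R >-> plane R} := HB.pack (dilate c : plane R -> plane R)
  (isMeasurableFun.Build _ _ _ _ _ (measurable_dilate c)).
apply: (@product_measure_unique _ _ _ _ _ _ _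
  (mscale (NngNum c20) (pushforward mu2 f))) => // B C mB mC.
transitivity ((c ^+ 2)%:E * mu2
  (((fun x => c * x)%R @^-1` B) `*` ((fun x => c * x)%R @^-1` C)))%E => //.
have mf : measurable_fun setT
    ((fun x => c * x) : measurableTypeR R -> measurableTypeR R).
  by apply: measurable_funM => //; exact: measurable_cst.
rewrite product_measure1E; last 2 first.
- by rewrite -[_ @^-1` _]setTI; exact: mf.
- by rewrite -[_ @^-1` _]setTI; exact: mf.
by rewrite expr2 EFinM muleACA; congr (_ * _)%E; exact: lebesgue_measure_dilate.
Qed.

End area_invariance.

(** * Arcs, sectors and annuli *)

Definition arc {R : realType} (a s : R) : set (plane R) :=
  @cis R @` `[a, a + s[%classic.

Definition sector {R : realType} (a s : R) : set (plane R) :=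
  [set z | z <> (0, 0) /\ arc a s (cdir z)].

Definition annulus {R : realType} (r1 r2 : R) : set (plane R) :=
  [set z | r1 < cmod z < r2].

Section polar.
Context {R : realType}.
Implicit Types (z : plane R) (a s t u r : R).

Lemma cmod_ge0 z : 0 <= cmod z. Proof. exact: sqrtr_ge0. Qed.

Lemma sqr_cmod z : cmod z ^+ 2 = z.1 ^+ 2 + z.2 ^+ 2.
Proof. by rewrite sqr_sqrtr// addr_ge0 ?sqr_ge0. Qed.

Lemma cmod_gt0 z : (0 < cmod z) <-> z <> (0, 0).
Proof.
split=> [+ z0|z0]; first by rewrite z0 /cmod/= expr0n/= addr0 sqrtr0 ltxx.
rewrite lt_neqAle cmod_ge0 andbT eq_sym; apply/eqP => c0; apply: z0.
have := sqr_cmod z; rewrite c0 expr0n/= => /eqP.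
rewrite eq_sym paddr_eq0 ?sqr_ge0// !sqrf_eq0 => /andP[/eqP z1 /eqP z2].
by rewrite [z]surjective_pairing z1 z2.
Qed.

Lemma cmod_rot a z : cmod (rot a z) = cmod z.
Proof.
congr Num.sqrt; rewrite /rot/=.
have e : sin a * sin a = 1 - cos a * cos a.
  by rewrite -[1](cos2Dsin2 a); ring.
by ring: e.
Qed.

Lemma cmod_dilate r z : 0 <= r -> cmod (dilate r z) = r * cmod z.
Proof.
move=> r0; rewrite /cmod /dilate/= !exprMn -mulrDr.
by rewrite sqrtrM ?sqr_ge0// sqrtr_sqr ger0_norm.
Qed.

Lemma rot_cis a t : rot a (cis t) = cis (t + a).
Proof. by rewrite /rot /cis/= cosD sinD; congr pair; ring. Qed.

Lemma rotK a : cancel (rot a) (@rot R (- a)).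
Proof.
move=> [x y]; rewrite /rot/= cosN sinN.
have e : sin a * sin a = 1 - cos a * cos a.
  by rewrite -[1](cos2Dsin2 a); ring.
by congr pair; ring: e.
Qed.

Lemma cdir_rot a z : cdir (rot a z) = rot a (cdir z).
Proof. by rewrite /cdir cmod_rot /rot/=; congr pair; ring. Qed.

Lemma cdir_dilate r z : 0 < r -> cdir (dilate r z) = cdir z.
Proof.
move=> r0; rewrite /cdir cmod_dilate ?ltW// /dilate/=.
by rewrite -!mulf_div divff ?gt_eqF// !mul1r.
Qed.

Lemma sqr_cdir z : z <> (0, 0) -> (cdir z).1 ^+ 2 + (cdir z).2 ^+ 2 = 1.
Proof.
move=> /cmod_gt0 z0; rewrite /cdir/= !exprMn -mulrDl -sqr_cmod.
by rewrite exprVn divff// expf_neq0// gt_eqF.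
Qed.

Lemma measurable_cmod : measurable_fun setT (@cmod R).
Proof.
apply: measurableT_comp; first exact: continuous_measurable_fun (@sqrt_continuous R).
by apply: measurable_funD; apply: measurable_funX;
  [exact: measurable_fst|exact: measurable_snd].
Qed.

(** [cos] determines t in [0, pi], and [sin u] is negative for u in
    ]pi, 2 pi[. *)
Lemma cis_inj_half t u : 0 <= t <= pi -> 0 <= u < 2 * pi ->
  cis t = cis u -> t = u.
Proof.
move=> tI uI [ct st]; have [upi|pu] := leP u pi.
  by apply: cos_inj => //; rewrite in_itv/= ?tI// upi andbT; case/andP: uI.
have st0 : 0 <= sin t by exact: sin_ge0_pi.
have : 0 < sin (u - pi).
  apply: sin_gt0_pi; rewrite subr_gt0 pu/=.
  by case/andP: uI => _; rewrite ltrBlDr mulr2n mulrDl mul1r.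
have := sinDpi (u - pi); rewrite subrK => su.
by move: st0; rewrite st su; lra.
Qed.

Lemma arclen_arc a s : 0 <= a -> 0 < s -> a + s <= pi ->
  arclen (arc a s) = (s / (2 * pi))%:E.
Proof.
move=> a0 s0 aspi; rewrite /arclen.
have -> : [set t : R | 0 <= t < 2 * pi /\ arc a s (cis t)] = `[a, a + s[%classic.
  apply/seteqP; split => t /=.
    move=> [tI [u]]; rewrite /= !in_itv/= => /andP[au us] ut.
    by rewrite -(cis_inj_half _ tI ut) ?au// (le_trans a0 au)/= ltW// (lt_le_trans us).
  rewrite in_itv/= => /andP[au us]; split; last by exists t; rewrite //= in_itv/= au us.
  rewrite (le_trans a0 au)/= (lt_le_trans us)// (le_trans aspi)//.
  by rewrite mulrDl mul1r lerDl pi_ge0.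
rewrite lebesgue_measure_itv/= lte_fin ltrDl s0 -EFinB -EFinM.
by congr EFin; rewrite mulrC; congr (_ / _); ring.
Qed.

Lemma is_arc_arc a s : 0 <= a -> 0 < s -> a + s <= pi -> is_arc (arc a s).
Proof.
move=> a0 s0 aspi; split.
  by exists `[a, a + s[%classic => //; exact: interval_is_interval.
by rewrite arclen_arc// lte_fin divr_gt0// mulr_gt0// pi_gt0.
Qed.

Lemma sector_rot a s : sector a s = rot (- a) @^-1` sector 0 s.
Proof.
apply/seteqP; split => z /= [z0 [t]]; rewrite /= in_itv/= => /andP[at_ ts] zt; split.
- by apply/cmod_gt0; rewrite cmod_rot; exact/cmod_gt0.
- exists (t - a); first by rewrite /= in_itv/= add0r subr_ge0 at_/= ltrBlDl.
  by rewrite cdir_rot -zt rot_cis.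
- by apply/cmod_gt0; rewrite -(cmod_rot (- a)); exact/cmod_gt0.
- exists (t + a).
    by rewrite /= in_itv/= lerDr at_/= addrC ltrD2l; move: ts; rewrite add0r.
  by rewrite -rot_cis zt cdir_rot; have := rotK (- a) (cdir z); rewrite opprK.
Qed.

(** Half-plane description of a sector issued from the positive real axis, which
    makes its measurability visible. *)
Lemma sector0E s : 0 < s <= pi ->
  sector 0 s = [set z | 0 <= z.2 /\ cos s * cmod z < z.1].
Proof.
move=> /andP[s0 spi]; apply/seteqP; split => z /=.
  move=> [/cmod_gt0 z0 [t]]; rewrite /= in_itv/= add0r => /andP[t0 ts] [c1 c2].
  have tpi : t <= pi by rewrite ltW// (lt_le_trans ts).
  split.
    have : 0 <= z.2 / cmod z by rewrite -c2 sin_ge0_pi// t0.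
    by rewrite pmulr_lge0// invr_gt0.
  rewrite -ltr_pdivlMr// -c1 ltr_cos// in_itv/= ?t0// ltW//.
move=> [z2 cz].
have z0 : z <> (0, 0).
  by move=> z0; move: cz; rewrite z0 /cmod/= expr0n/= addr0 sqrtr0 mulr0 ltxx.
split => //; have /cmod_gt0 z0' := z0.
have e := sqr_cdir z0.
have xI : -1 <= (cdir z).1 <= 1.
  by rewrite -ler_norml -(@expr_le1 _ 2)// -normrX ger0_norm ?sqr_ge0// -e lerDl sqr_ge0.
exists (acos (cdir z).1); last first.
  rewrite /cis acosK; last by rewrite in_itv.
  rewrite sin_acos// -e addrAC subrr add0r sqrtr_sqr ger0_norm -?surjective_pairing//.
  by rewrite /= divr_ge0// cmod_ge0.
rewrite /= in_itv/= acos_ge0//= add0r -ltr_cos ?in_itv/= ?acos_ge0 ?acos_lepi//.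
  by rewrite acosK ?in_itv//= ltr_pdivlMr.
by rewrite spi ltW.
Qed.

Lemma measurable_sector a s : 0 < s <= pi -> measurable (sector a s).
Proof.
move=> s0; rewrite sector_rot; apply: measurable_preimageT; first exact: measurable_rot.
rewrite sector0E//.
rewrite [X in measurable X](_ : _ =
   (snd @^-1` `[0, +oo[%classic) `&`
   ((fun z : plane R => z.1 - cos s * cmod z) @^-1` `]0, +oo[%classic)); last first.
  by apply/seteqP; split => z /=; rewrite !in_itv/= !andbT subr_gt0.
apply: measurableI.
  by rewrite -[_ @^-1` _]setTI; apply: measurable_snd.
rewrite -[_ @^-1` _]setTI.
have : measurable_fun setT (fun z : plane R => z.1 - cos s * cmod z).
  apply: measurable_funB; first exact: measurable_fst.
  by apply: measurable_funM; [exact: measurable_cst|exact: measurable_cmod].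
exact.
Qed.

Lemma measurable_annulus r1 r2 : measurable (@annulus R r1 r2).
Proof.
rewrite [X in measurable X](_ : _ = setT `&` @cmod R @^-1` `]r1, r2[%classic); last first.
  by apply/seteqP; split => z /=; rewrite !in_itv//= => -[].
exact: measurable_cmod.
Qed.

Lemma carleson_arc a s : 0 <= a -> 0 < s -> a + s <= pi ->
  carleson (arc a s) = sector a s `&` annulus (1 - s / (2 * pi)) 1.
Proof.
move=> a0 s0 aspi; rewrite /carleson arclen_arc//; apply/seteqP; split => z /=.
  move=> [z1 z0 za]; rewrite lte_fin => zs; split=> //.
  by rewrite /annulus/= ltrBlDl -ltrBlDr zs z1.
by move=> [[z0 za] /andP[z1 z2]]; split => //; rewrite lte_fin ltrBlDl -ltrBlDr.
Qed.

End polar.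

(** * Areas of sectors and integrals of radial functions *)

(** The normalized area of a sector of angle s of the unit disc, s / (2 pi). *)
Definition wedge {R : realType} (s : R) : R :=
  fine (area R (sector 0 s `&` annulus 0 1)).

Section sector_area.
Context {R : realType}.
Implicit Types (z : plane R) (a s t u r : R).

Lemma measurable_sector_annulus a s r1 r2 : 0 < s <= pi ->
  measurable (sector a s `&` annulus r1 r2).
Proof.
by move=> s0; apply: measurableI; [exact: measurable_sector|exact: measurable_annulus].
Qed.

Lemma area_setX (A B : set (measurableTypeR R)) : measurable A -> measurable B ->
  (area R (A `*` B) =
    (pi^-1)%:E * (lebesgue_measure A * lebesgue_measure B))%E.
Proof. by move=> mA mB; congr (_ * _)%E; exact: product_measure1E. Qed.

Lemma area_annulus_lty r1 r2 : (area R (annulus r1 r2) < +oo)%E.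
Proof.
apply: (@le_lt_trans _ _ (area R (`[- r2, r2]%classic `*` `[- r2, r2]%classic))).
  apply: le_measure; rewrite ?inE.
  - exact: measurable_annulus.
  - exact: measurableX.
  move=> z /andP[_ /ltW zr]; split; rewrite /= in_itv/= -ler_norml (le_trans _ zr)//.
    by rewrite -sqrtr_sqr ler_wsqrtr// lerDl sqr_ge0.
  by rewrite -sqrtr_sqr ler_wsqrtr// lerDr sqr_ge0.
rewrite area_setX//= lebesgue_measure_itv/=.
by case: ifP => _; rewrite ?mule0 ?ltry// -EFinB -!EFinM ltry.
Qed.

Lemma area_sector_annulus_fin a s r1 r2 : 0 < s <= pi ->
  area R (sector a s `&` annulus r1 r2) \is a fin_num.
Proof.
move=> s0; rewrite ge0_fin_numE//; apply: le_lt_trans (area_annulus_lty r1 r2).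
apply: le_measure; rewrite ?inE; last by move=> z [].
  exact: measurable_sector_annulus.
exact: measurable_annulus.
Qed.

Lemma sector_dilate a s c z : 0 < c -> sector a s (dilate c z) <-> sector a s z.
Proof.
move=> c0; rewrite /sector/= cdir_dilate//; split=> -[/cmod_gt0 z0 za]; split => //;
  apply/cmod_gt0; move: z0; rewrite cmod_dilate ?ltW// pmulr_rgt0//.
Qed.

Lemma area_sector_disc s r : 0 < s <= pi -> 0 < r ->
  area R (sector 0 s `&` annulus 0 r) = (r ^+ 2 * wedge s)%:E.
Proof.
move=> s0 r0; rewrite EFinM fineK ?area_sector_annulus_fin//.
rewrite [LHS](area_dilate r0); last exact: measurable_sector_annulus.
congr (_ * area R _)%E; apply/seteqP; split => z /= [zs];
  rewrite /annulus/= cmod_dilate ?ltW// pmulr_rgt0// gtr_pMr// => zr; split => //.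
  exact/(sector_dilate _ _ _ r0).
exact/(sector_dilate _ _ _ r0).
Qed.

(** Near the positive real axis the sector contains a small rectangle. *)
Lemma wedge_gt0 s : 0 < s <= pi -> 0 < wedge s.
Proof.
move=> /[dup] s0 /andP[s_gt0 spi].
have c1 : cos s < 1.
  by rewrite -cos0 ltr_cos// in_itv/= ?lexx ?pi_ge0// spi ltW.
pose c := Num.max (cos s) 0; have c0 : 0 <= c by rewrite le_max lexx orbT.
have cs : cos s <= c by rewrite le_max lexx.
have {}c1 : c < 1 by rewrite gt_max c1 ltr01.
(* For x > 1/4 and 0 < y < d one has c^2 y^2 < (1 - c^2) x^2, that is
   c |(x, y)| < x. *)
pose d := (1 - c ^+ 2) / 4.
have d0 : 0 < d by rewrite divr_gt0// subr_gt0 expr_lt1.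
have d1 : d <= 1 / 4 by rewrite ler_pM2r ?invr_gt0// gerBl sqr_ge0.
rewrite -lte_fin fineK ?area_sector_annulus_fin//.
apply: (@lt_le_trans _ _
  (area R (`]4^-1, 2^-1[%classic `*` `]0, d[%classic))).
  rewrite area_setX//= !lebesgue_measure_itv/= !lte_fin.
  rewrite d0 ltf_pV2 ?posrE// ltr_nat/= -!EFinB -!EFinM lte_fin.
  by rewrite !mulr_gt0// ?invr_gt0 ?pi_gt0// subr_gt0// ltf_pV2 ?posrE// ltr_nat.
apply: le_measure; rewrite ?inE.
- exact: measurableX.
- exact: measurable_sector_annulus.
move=> [x y] [] /=; rewrite !in_itv/= => /andP[x1 x2] /andP[y1 y2].
have x0 : 0 < x by lra.
have zx : 0 < cmod (x, y) by apply/cmod_gt0 => -[xE _]; move: x0; rewrite xE ltxx.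
have ez := sqr_cmod (x, y); rewrite /= in ez.
rewrite sector0E//; split; last first.
  rewrite /annulus/= zx/= -(@expr_lt1 _ 2) ?cmod_ge0// ez.
  have : x * x < 2^-1 * 2^-1 by apply: ltr_pM => //; exact: ltW.
  have : y * y < d * d by apply: ltr_pM => //; exact: ltW.
  have : d * d <= 1 / 4 * (1 / 4) by apply: ler_pM => //; exact: ltW.
  rewrite !expr2; lra.
split => /=; first exact: ltW.
apply: (@le_lt_trans _ _ (c * cmod (x, y))); first by rewrite ler_pM2r.
have cz0 : 0 <= c * cmod (x, y) by rewrite mulr_ge0// ltW.
rewrite -(ltr_pXn2r (n := 2)) ?nnegrE//; last exact: ltW.
rewrite exprMn ez.
have yd : y * y < d * d by apply: ltr_pM => //; exact: ltW.
have xx : 4^-1 * 4^-1 < x * x by apply: ltr_pM.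
have c2 : 0 <= c ^+ 2 < 1 by rewrite sqr_ge0 expr_lt1.
move: c2 yd; rewrite /d !expr2; set k := c * c => /andP[k0 k1] yd.
have : k * (y * y) <= y * y by rewrite ler_piMl ?ltW// mulr_gt0.
have : (1 - k) * (4^-1 * 4^-1) < (1 - k) * (x * x) by rewrite ltr_pM2l// subr_gt0.
have : (1 - k) * (1 - k) <= 1 - k by rewrite ler_piMl ?gerBl// subr_ge0 ltW.
by nra.
Qed.

(** The two circles bounding the annulus are null sets; instead of measuring
    them, the annulus is squeezed between differences of discs. *)
Lemma area_sector_annulus s r1 r2 : 0 < s <= pi -> 0 < r1 -> r1 <= r2 ->
  area R (sector 0 s `&` annulus r1 r2) = ((r2 ^+ 2 - r1 ^+ 2) * wedge s)%:E.
Proof.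
move=> s0 r10 r12; have r20 := lt_le_trans r10 r12.
have finx := area_sector_annulus_fin 0 r1 r2 s0.
rewrite -(fineK finx); congr EFin; set x := fine _.
have xE : area R (sector 0 s `&` annulus r1 r2) = x%:E by rewrite fineK.
have mS q1 q2 := @measurable_sector_annulus 0 s q1 q2 s0.
apply/eqP; rewrite eq_le; apply/andP; split.
  rewrite mulrBl lerBrDr -lee_fin EFinD -!area_sector_disc// -xE.
  rewrite -measureU//=; last first.
    apply/seteqP; split => z //= [[_ /andP[z1 z2]] [_ /andP[z3 z4]]].
    by move: (lt_trans z1 z4); rewrite ltxx.
  apply: le_measure; rewrite ?inE//; first exact: measurableU.
  move=> z [[zs /andP[z1 z2]]|[zs /andP[z1 z2]]]; split => //; apply/andP; split => //.
    exact: lt_trans z1.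
  exact: lt_le_trans r12.
have D0 := ltW (wedge_gt0 s0).
rewrite mulrBl lerBlDr; apply/ler_addgt0Pr => e e0.
(* (1 + d)^2 <= 1 + 3 d for 0 <= d <= 1. *)
pose k := 3 * r1 ^+ 2 * wedge s.
have k0 : 0 <= k by rewrite !mulr_ge0// ltW.
pose d := Num.min 1 (e / (k + 1)).
have d0 : 0 < d by rewrite lt_min ltr01 divr_gt0// ltr_wpDl.
have d1 : d <= 1 by rewrite ge_min lexx.
have dk : d * k <= e.
  apply: (@le_trans _ _ (e / (k + 1) * (k + 1))); last by rewrite divfK// gt_eqF// ltr_wpDl.
  by rewrite ler_pM ?(ltW d0)// ?lerDl// ge_min lexx orbT.
have : (area R (sector 0 s `&` annulus 0 r2) <=
    area R (sector 0 s `&` annulus r1 r2) +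
    area R (sector 0 s `&` annulus 0 (r1 * (1 + d))))%E.
  apply: le_trans (measureU2 _ _ _); [|exact: mS|exact: mS].
  apply: le_measure; rewrite ?inE//; first exact: measurableU.
  move=> z [zs /andP[z1 z2]]; have [zr|rz] := leP (cmod z) r1.
    right; split => //; apply/andP; split => //.
    by rewrite (le_lt_trans zr)// ltr_pMr// ltrDl.
  by left; split => //; apply/andP.
rewrite !area_sector_disc// ?mulr_gt0// ?addr_gt0// xE -EFinD lee_fin.
move=> /le_trans; apply; rewrite -addrA lerD2l.
apply: le_trans (_ : r1 ^+ 2 * wedge s + d * k <= _); last by rewrite lerD2l.
rewrite /k -subr_ge0.
have -> : r1 ^+ 2 * wedge s + d * (3 * r1 ^+ 2 * wedge s) -
    (r1 * (1 + d)) ^+ 2 * wedge s = r1 ^+ 2 * wedge s * d * (1 - d) by ring.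
by rewrite !mulr_ge0 ?sqr_ge0 ?subr_ge0// ltW.
Qed.

End sector_area.

Section sector_integral.
Context {R : realType}.
Variables (r1 r2 : R) (f : plane R -> \bar R).
Hypothesis mf : measurable_fun (annulus r1 r2) f.
Hypothesis f0 : forall z, annulus r1 r2 z -> (0 <= f z)%E.
Hypothesis f_radial :
  forall z z', annulus r1 r2 z -> cmod z = cmod z' -> f z = f z'.
Implicit Types (z : plane R) (a s t u r : R).

Lemma integral_sector_rot a s : - pi < a < pi -> 0 < s <= pi ->
  (\int[area R]_(z in sector a s `&` annulus r1 r2) f z =
   \int[area R]_(z in sector 0 s `&` annulus r1 r2) f z)%E.
Proof.
move=> /andP[a1 a2] s0; have mrot := @measurable_rot R (- a).
pose phi : {mfun plane R >-> plane R} := HB.pack (rot (- a) : plane R -> plane R)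
  (isMeasurableFun.Build _ _ _ _ _ mrot).
have mS := @measurable_sector_annulus R 0 s r1 r2 s0.
transitivity (\int[pushforward (area R) phi]_(z in sector 0 s `&` annulus r1 r2) f z)%E.
  rewrite (ge0_integral_pushforward mrot)//; last 2 first.
  - by apply: measurable_funS mf; [exact: measurable_annulus|move=> z []].
  - by move=> z; rewrite inE => -[_ /f0].
  have -> : sector a s `&` annulus r1 r2 =
      rot (- a) @^-1` (sector 0 s `&` annulus r1 r2).
    by rewrite sector_rot; apply/seteqP; split => z; rewrite /= /annulus/= cmod_rot.
  apply: eq_integral => z; rewrite inE /= => -[_ zA].
  by apply: f_radial; rewrite /annulus/= ?cmod_rot//; move: zA; rewrite /annulus/= cmod_rot.
apply: eq_measure_integral => A mA _.
by apply: area_rot => //; rewrite ltrN2 a2 ltrNl a1.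
Qed.

Lemma sectorD s : 0 < s -> sector 0 (s + s) = sector 0 s `|` @sector R s s.
Proof.
move=> s0; apply/seteqP; split => z.
  move=> [z0 [t]]; rewrite /= in_itv/= add0r => /andP[t0 tss] zt.
  have [ts|st] := ltP t s; [left|right]; split => //; exists t => //=;
    by rewrite in_itv/= ?add0r ?t0 ?st.
by move=> [|] [z0 [t]]; rewrite /= in_itv/= ?add0r => /andP[t0 ts] zt; split => //;
  exists t => //=; rewrite in_itv/= add0r ?t0 ?(le_trans (ltW s0) t0)//=
    (lt_trans ts)// ltrDl.
Qed.

Lemma sector_disjoint s : 0 < s -> s + s <= pi -> sector 0 s `&` @sector R s s = set0.
Proof.
move=> s0 sspi; apply/seteqP; split => z //.
move=> [[_ [t]]]; rewrite /= in_itv/= add0r => /andP[t0 ts] tz.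
move=> [_ [u]]; rewrite /= in_itv/= => /andP[u0 us]; rewrite -tz => /esym tu.
have pi0 := @pi_gt0 R.
have e : t = u by apply: cis_inj_half => //; lra.
by lra.
Qed.

Lemma integral_sector_double s : 0 < s -> s + s <= pi ->
  (\int[area R]_(z in sector 0 (s + s) `&` annulus r1 r2) f z =
   2%:E * \int[area R]_(z in sector 0 s `&` annulus r1 r2) f z)%E.
Proof.
move=> s0 sspi.
have s1 : 0 < s <= pi by lra.
have mS a := @measurable_sector_annulus R a s r1 r2 s1.
rewrite sectorD// setIUl ge0_integral_setU//; last 3 first.
- apply: measurable_funS mf; first exact: measurable_annulus.
  by move=> z [] [].
- by move=> z [] [_ /f0].
- by apply/disj_setPS; rewrite setIACA sector_disjoint// set0I.
have s2 : - pi < s < pi by lra.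
by rewrite (integral_sector_rot s2 s1) mule_natl mule2n.
Qed.

(** Halving the angle repeatedly: the two halves of a sector are rotations of each
    other. *)
Lemma integral_sector_pow2 s k : 0 < s -> 2 ^+ k * s <= pi ->
  (\int[area R]_(z in sector 0 (2 ^+ k * s)%R `&` annulus r1 r2) f z =
   (2 ^+ k)%:E * \int[area R]_(z in sector 0 s `&` annulus r1 r2) f z)%E.
Proof.
move=> s0; elim: k => [|k IH]; first by rewrite expr0 mul1r mul1e.
rewrite exprS => kpi.
have e : 2 * 2 ^+ k * s = 2 ^+ k * s + 2 ^+ k * s :> R by ring.
have ks0 : 0 < 2 ^+ k * s by rewrite mulr_gt0// exprn_gt0.
by rewrite e integral_sector_double -?e// IH ?EFinM ?muleA//; lra.
Qed.

End sector_integral.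

Section sector_area_symmetry.
Context {R : realType}.
Implicit Types (a s r : R).

Let integral_one (A : set (plane R)) : measurable A ->
  area R A = (\int[area R]_(z in A) (cst 1%E) z)%E.
Proof. by move=> mA; rewrite integral_cst// mul1e. Qed.

Lemma area_sector_rot a s r1 r2 : - pi < a < pi -> 0 < s <= pi ->
  area R (sector a s `&` annulus r1 r2) = area R (sector 0 s `&` annulus r1 r2).
Proof.
move=> a0 s0; rewrite integral_one; last exact: measurable_sector_annulus.
rewrite [RHS]integral_one; last exact: measurable_sector_annulus.
by apply: integral_sector_rot => //; exact: measurable_cst.
Qed.

Lemma wedge_pow2 s k : 0 < s -> 2 ^+ k * s <= pi ->
  wedge (2 ^+ k * s) = 2 ^+ k * wedge s.
Proof.
move=> s0 kpi.
have ks0 : 0 < 2 ^+ k * s <= pi by rewrite mulr_gt0// exprn_gt0.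
have spi : 0 < s <= pi.
  by rewrite s0/= (le_trans _ kpi)// ler_peMl ?(ltW s0)// exprn_ege1 ?ler1n.
apply: EFin_inj; rewrite EFinM /wedge.
rewrite fineK; last exact: area_sector_annulus_fin.
rewrite fineK; last exact: area_sector_annulus_fin.
rewrite integral_one; last exact: measurable_sector_annulus.
rewrite [X in _ = (_ * X)%E]integral_one; last exact: measurable_sector_annulus.
by apply: integral_sector_pow2 => //; exact: measurable_cst.
Qed.

End sector_area_symmetry.

(** * Mean values *)

Section mean_values.
Context {R : realType}.
Variable Q : set (plane R).
Hypothesis mQ : measurable Q.
Variable q : R.
Hypotheses (q0 : 0 < q) (qE : area R Q = q%:E).
Local Open Scope ereal_scope.
Implicit Types f g : plane R -> \bar R.

Lemma avgE f : avg Q f = (q^-1)%:E * \int[area R]_(z in Q) f z.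
Proof. by rewrite /avg qE. Qed.

Lemma avg_ge0 f : (forall z, Q z -> 0 <= f z) -> 0 <= avg Q f.
Proof. by move=> f0; rewrite avgE mule_ge0 ?integral_ge0// lee_fin invr_ge0 ltW. Qed.

Lemma avg_lower_bound f B (c b : R) : measurable_fun Q f ->
  (forall z, Q z -> 0 <= f z) -> measurable B -> B `<=` Q -> (0 <= c)%R ->
  (forall z, B z -> c%:E <= f z) -> b%:E * area R Q <= area R B ->
  (b * c)%:E <= avg Q f.
Proof.
move=> mf f0 mB BQ c0 cf bB; rewrite avgE lee_pdivlMl//.
apply: (@le_trans _ _ (\int[area R]_(z in B) f z)); last exact: ge0_subset_integral.
apply: (@le_trans _ _ (\int[area R]_(z in B) (cst c%:E) z)); last first.
  apply: ge0_le_integral => //.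
  exact: measurable_funS mf.
rewrite integral_cst//= -EFinM mulrA mulrC EFinM lee_wpmul2l ?lee_fin//.
by rewrite mulrC EFinM -qE.
Qed.

(** [f] may have integral -oo, as can happen for the logarithm of a
    decreasing weight. *)
Lemma le_integral_integrable_right f g : measurable_fun Q f ->
  (area R).-integrable Q g -> (forall z, Q z -> f z <= g z) ->
  \int[area R]_(z in Q) f z <= \int[area R]_(z in Q) g z.
Proof.
move=> mf ig fg; have /integrableP[mg _] := ig.
rewrite integralE [leRHS]integralE; apply: leeB.
  apply: ge0_le_integral => //; [exact: measurable_funepos|exact: measurable_funepos|].
  by move=> z Qz; rewrite !funeposE ge_max !le_max fg//= lexx orbT.
apply: ge0_le_integral => //; [exact: measurable_funeneg|exact: measurable_funeneg|].
by move=> z Qz; rewrite !funenegE ge_max !le_max leeN2 fg//= lexx orbT.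
Qed.

End mean_values.

(** * Control of large values by small ones *)

(** A weight that is at most m on most of a Carleson square cannot exceed a
    constant times m on a fixed proportion of it. The proportion lam that may be
    left out of S depends on the weight only and may be tiny, as reverse Hölder
    with a large constant gives no more. *)
Definition level_control {R : realType} (w : plane R -> \bar R) : Prop :=
  exists2 lam : R, 0 < lam < 1 & forall b : R, 0 < b ->
  exists2 C : R, 0 < C & forall I (S B : set (plane R)) (m M : R),
    is_arc I -> measurable (carleson I) -> (0 < area R (carleson I))%E ->
    measurable S -> S `<=` carleson I -> measurable B -> B `<=` carleson I ->
    0 < m -> 0 < M ->
    (forall z, S z -> (w z <= m%:E)%E) -> (forall z, B z -> (M%:E <= w z)%E) ->
    ((1 - lam)%:E * area R (carleson I) <= area R S)%E ->
    (b%:E * area R (carleson I) <= area R B)%E ->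
    M <= C * m.

Section level_control.
Context {R : realType}.
Variable w : plane R -> \bar R.
Hypothesis iw : (area R).-integrable (disc R) w.
Hypothesis w_fin : forall z, disc R z -> (0 < w z < +oo)%E.
Local Open Scope ereal_scope.

Lemma measurable_disc : measurable (disc R).
Proof.
rewrite [X in measurable X](_ : _ = setT `&` @cmod R @^-1` `]-oo, 1%R[%classic); last first.
  by apply/seteqP; split => z /=; rewrite in_itv//= => -[].
exact: measurable_cmod.
Qed.

Lemma carleson_disc I : carleson I `<=` disc R.
Proof. by move=> z []. Qed.

Lemma carleson_area I : measurable (carleson I) -> 0 < area R (carleson I) ->
  exists2 q : R, (0 < q)%R & area R (carleson I) = q%:E.
Proof.
move=> mQ Q0; exists (fine (area R (carleson I))).
  rewrite fine_gt0// Q0 (le_lt_trans _ (area_annulus_lty 0 1))//.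
  apply: le_measure; rewrite ?inE//; first exact: measurable_annulus.
  by move=> z [z1 z0 _ _]; rewrite /annulus/= z1 andbT; exact/cmod_gt0.
rewrite fineK// ge0_fin_numE// (le_lt_trans _ (area_annulus_lty 0 1))//.
apply: le_measure; rewrite ?inE//; first exact: measurable_annulus.
by move=> z [z1 z0 _ _]; rewrite /annulus/= z1 andbT; exact/cmod_gt0.
Qed.

Lemma weight_ge0_carleson I z : carleson I z -> 0 <= w z.
Proof. by move=> /carleson_disc /w_fin /andP[/ltW]. Qed.

Lemma weight_EFin_carleson I z : carleson I z -> exists2 u : R, (0 < u)%R & w z = u%:E.
Proof.
move=> /carleson_disc /w_fin; case: (w z) => [u||]; [|by rewrite ltxx andbF|by []].
by rewrite lte_fin => /andP[u0 _]; exists u.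
Qed.

Lemma weight_measurable_carleson I :
  measurable (carleson I) -> measurable_fun (carleson I) w.
Proof.
move=> mQ; have /integrableP[mw _] := iw.
apply: measurable_funS mw; last exact: carleson_disc.
exact: measurable_disc.
Qed.

Lemma weight_integrable_carleson I :
  measurable (carleson I) -> (area R).-integrable (carleson I) w.
Proof.
by move=> mQ; apply: (integrableS measurable_disc mQ _ iw); exact: carleson_disc.
Qed.

Lemma avg_weight I (q : R) :
  measurable (carleson I) -> (0 < q)%R -> area R (carleson I) = q%:E ->
  exists x : R, avg (carleson I) w = x%:E /\
    \int[area R]_(z in carleson I) w z = (q * x)%:E.
Proof.
move=> mQ q0 qE; have iQ := weight_integrable_carleson mQ.
have := integrable_fin_num mQ iQ => /fineK iE.
exists (q^-1 * fine (\int[area R]_(z in carleson I) w z))%R.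
rewrite (avgE qE) -iE; split => //.
by rewrite mulrA divff ?gt_eqF// mul1r.
Qed.

(** The mean of [w] is at least b M, and the mean of w^(1 - p') at least
    m^(1 - p') / 2, whose power p - 1 is a constant times 1 / m. *)
Lemma Bp_level_control p : (1 < p)%R -> Bp p w -> level_control w.
Proof.
move=> p1 [_ [C [C0 HC]]]; exists (2^-1)%R; first by lra.
move=> b b0; pose k : R := (2^-1 `^ (p - 1))%R.
have k0 : (0 < k)%R by rewrite powR_gt0.
exists (C / (b * k))%R; first by rewrite divr_gt0// mulr_gt0.
move=> I S B m M arcI mQ Q0 mS SQ mB BQ m0 M0 wm wM Sl Bl.
have [q q0 qE] := carleson_area mQ Q0.
(* e is 1 - p', equal to -1 / (p - 1). *)
pose e : R := (1 - p / (p - 1))%R.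
have p10 : (0 < p - 1)%R by rewrite subr_gt0.
have eE : e = (- (p - 1)^-1)%R by rewrite /e; field; rewrite gt_eqF.
have mw := weight_measurable_carleson mQ.
have lowM : (b * M)%:E <= avg (carleson I) w.
  apply: (avg_lower_bound mQ q0 qE mw _ mB BQ _ wM Bl); last exact: ltW.
  exact: weight_ge0_carleson.
have lowm : ((1 - 2^-1) * m `^ e)%:E <= avg (carleson I) (fun z => w z `^ e).
  apply: (avg_lower_bound mQ q0 qE _ _ mS SQ _ _ Sl) => //.
  - exact: (measurableT_comp (measurable_poweR _)).
  - by move=> z _; exact: poweR_ge0.
  - exact: powR_ge0.
  move=> z Sz; have [u u0 zu] := weight_EFin_carleson (SQ _ Sz).
  have := wm _ Sz; rewrite zu poweR_EFin !lee_fin => um.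
  rewrite eE !powRN lef_pV2 ?posrE ?powR_gt0// ge0_ler_powR ?nnegrE ?invr_ge0// ltW//.
have h : (1 - 2^-1 = 2^-1 :> R)%R by field.
rewrite h in lowm.
have {}lowm : (k * m^-1)%:E <= (avg (carleson I) (fun z => w z `^ e)) `^ (p - 1).
  apply: (@le_trans _ _ ((2^-1 * m `^ e)%:E `^ (p - 1))).
    rewrite poweR_EFin lee_fin powRM ?powR_ge0// -powRrM eE mulNr mulVf ?gt_eqF//.
    by rewrite powR_inv1// ltW.
  apply: gt0_ler_poweR => //; [exact: ltW| |]; rewrite in_itv/= leey andbT.
    by rewrite lee_fin mulr_ge0// powR_ge0.
  by apply: (le_trans _ lowm); rewrite lee_fin mulr_ge0// powR_ge0.
have : (b * M * (k * m^-1))%:E <= C%:E.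
  apply: le_trans (HC _ arcI); rewrite EFinM; apply: lee_pmul => //;
    by rewrite lee_fin mulr_ge0// ?invr_ge0 ltW.
rewrite lee_fin.
rewrite -(@ler_pM2r _ (m / (b * k))%R) ?divr_gt0 ?mulr_gt0//.
have -> : (b * M * (k / m) * (m / (b * k)) = M)%R by field; rewrite !gt_eqF.
by move=> /le_trans; apply; rewrite mulrA mulrAC.
Qed.

(** With T = K x, where x is the mean of [w], integrating the pointwise inequality
    w <= m + T 1_(Q \ S) + T^(1 - r) w^r gives
    x <= m + K lam x + K^(1 - r) C^r x. The constant K is chosen to make the last
    coefficient 1 / 4, then lam to make the previous one at most 1 / 4. *)
Lemma reverse_Hoelder_level_control : reverse_Hoelder w -> level_control w.
Proof.
move=> [_ [r [C [r1 C0 HC]]]].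
pose K : R := ((4 * C `^ r) `^ (r - 1)^-1)%R.
have Cr0 : (0 < C `^ r)%R by rewrite powR_gt0.
have K0 : (0 < K)%R by rewrite powR_gt0// mulr_gt0.
have r10 : (r - 1 != 0)%R by rewrite subr_eq0 gt_eqF.
have KE : (K `^ (1 - r) * C `^ r = 4^-1)%R.
  rewrite -powRrM (_ : (r - 1)^-1 * (1 - r) = -1)%R; last by field.
  by rewrite powR_inv1 ?mulr_ge0 ?powR_ge0//; field; rewrite gt_eqF.
pose lam : R := (Num.min 2^-1 (4 * K)^-1)%R.
have lam0 : (0 < lam)%R by rewrite lt_min !invr_gt0 mulr_gt0// ltr0n.
have lam1 : (lam <= 2^-1)%R by rewrite ge_min lexx.
have Klam : (K * lam <= 4^-1)%R.
  apply: (@le_trans _ _ (K * (4 * K)^-1)%R).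
    by rewrite ler_pM2l// ge_min lexx orbT.
  by rewrite invfM mulrCA divff ?gt_eqF// mulr1.
exists lam; first by lra.
move=> b b0; exists (2 / b)%R; first by rewrite divr_gt0.
move=> I S B m M arcI mQ Q0 mS SQ mB BQ m0 M0 wm wM Sl Bl.
have [q q0 qE] := carleson_area mQ Q0.
have mw := weight_measurable_carleson mQ.
have lowM : (b * M)%:E <= avg (carleson I) w.
  apply: (avg_lower_bound mQ q0 qE mw _ mB BQ _ wM Bl); last exact: ltW.
  exact: weight_ge0_carleson.
have [x [avgx intx]] := avg_weight mQ q0 qE.
rewrite avgx lee_fin in lowM.
have x0 : (0 < x)%R by apply: lt_le_trans lowM; rewrite mulr_gt0.
suff x2m : (x <= 2 * m)%R.
  rewrite mulrAC ler_pdivlMr// mulrC; exact: le_trans x2m.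
have r0 : (0 < r)%R by rewrite (lt_trans _ r1).
have wr0 z : carleson I z -> 0 <= w z `^ r by move=> _; exact: poweR_ge0.
have mwr : measurable_fun (carleson I) (fun z => w z `^ r).
  exact: (measurableT_comp (measurable_poweR _)).
have Yx : avg (carleson I) (fun z => w z `^ r) <= ((C * x) `^ r)%:E.
  have := HC _ arcI; rewrite avgx -EFinM => H.
  rewrite -poweR_EFin -[leLHS]poweRe1; last exact: (avg_ge0 q0 qE).
  rewrite -[1%R](mulVf (lt0r_neq0 r0)) poweRrM.
  by apply: gt0_ler_poweR => //; [exact: ltW| |]; rewrite in_itv/= leey andbT ?poweR_ge0//
    lee_fin mulr_ge0// ltW.
pose T : R := (K * x)%R.
have T0 : (0 < T)%R by rewrite mulr_gt0.
have Y : \int[area R]_(z in carleson I) (w z `^ r) <= (q * (C * x) `^ r)%:E.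
  by move: Yx; rewrite (avgE qE) lee_pdivrMl// EFinM.
have ind0 z : (0 <= \1_(carleson I `\` S) z :> R)%R by rewrite indicE.
have mD : measurable (carleson I `\` S) by exact: measurableD.
have aD : area R (carleson I `\` S) <= (lam * q)%:E.
  have Qlt : area R (carleson I) < +oo by rewrite qE ltry.
  rewrite (measureD mQ mS Qlt) setIidr// [X in X - _]qE.
  rewrite leeBlDr; last first.
    rewrite ge0_fin_numE// (@le_lt_trans _ _ q%:E) ?ltry// -qE.
    by apply: le_measure; rewrite ?inE.
  move: Sl; rewrite qE -EFinM => Sl.
  apply: le_trans (leeD2l _ Sl); rewrite -EFinD lee_fin; lra.
have mTind : measurable_fun (carleson I)
    (fun z => (T * \1_(carleson I `\` S) z)%:E).
  apply/measurable_EFinP; apply: measurable_funM; first exact: measurable_cst.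
  exact: measurable_indic.
have mTmind : measurable_fun (carleson I)
    (fun z => m%:E + (T * \1_(carleson I `\` S) z)%:E).
  by apply: emeasurable_funD => //; exact: measurable_cst.
have mTw : measurable_fun (carleson I) (fun z => (T `^ (1 - r))%:E * w z `^ r).
  exact: emeasurable_funM.
have : \int[area R]_(z in carleson I) w z <=
    \int[area R]_(z in carleson I)
      ((m%:E + (T * \1_(carleson I `\` S) z)%:E) + (T `^ (1 - r))%:E * w z `^ r).
  apply: ge0_le_integral => //; first exact: weight_ge0_carleson.
  - exact: emeasurable_funD.
  move=> z Qz; have [u u0 zu] := weight_EFin_carleson Qz; rewrite zu.
  rewrite poweR_EFin -EFinM -!EFinD lee_fin indicE.
  have i0 : (0 <= T `^ (1 - r) * u `^ r)%R by rewrite mulr_ge0// powR_ge0.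
  have [Sz|nSz] := pselect (S z).
    have := wm _ Sz; rewrite zu lee_fin => um.
    rewrite memNset ?mulr0 ?addr0; last by move=> -[].
    by rewrite (le_trans um)// lerDl.
  rewrite mem_set// mulr1.
  (* Off S, either u <= T or u <= (u / T)^(r - 1) u. *)
  have [uT|Tu] := leP u T; first by lra.
  suff : (u <= T `^ (1 - r) * u `^ r)%R by lra.
  have -> : (1 - r = - (r - 1))%R by ring.
  have -> : (u `^ r = u `^ (r - 1) * u)%R.
    rewrite -[X in (_ * X)%R](powRr1 (ltW u0)) -powRD ?subrK//.
    by rewrite gt_eqF ?implybT.
  rewrite mulrA ler_peMl ?(ltW u0)// powRN mulrC ler_pdivlMr ?powR_gt0// mul1r.
  by rewrite ge0_ler_powR ?nnegrE ?subr_ge0 ?(ltW r1) ?(ltW T0) ?(ltW u0) ?(ltW Tu).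
rewrite ge0_integralD//; last 2 first.
- by move=> z _; rewrite -EFinD lee_fin; apply: addr_ge0; [exact: ltW|
    apply: mulr_ge0; [exact: ltW|exact: ind0]].
- by move=> z _; rewrite mule_ge0 ?poweR_ge0// lee_fin powR_ge0.
rewrite ge0_integralD//; last 2 first.
- by move=> z _; rewrite lee_fin ltW.
- by move=> z _; rewrite lee_fin; apply: mulr_ge0; [exact: ltW|exact: ind0].
rewrite integral_cst// qE.
under [X in _ + X + _]eq_integral do rewrite EFinM.
rewrite (ge0_integralZl_EFin _ _ _ _ (ltW T0))//; last first.
  by apply/measurable_EFinP; exact: measurable_indic.
rewrite integral_indic// setIidl; last by move=> z [].
rewrite ge0_integralZl_EFin ?powR_ge0//.
rewrite intx => main.
have : (q * x)%:E <= m%:E * q%:E + T%:E * (lam * q)%:E +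
    (T `^ (1 - r))%:E * (q * (C * x) `^ r)%:E.
  apply: (le_trans main); apply: leeD; last by rewrite lee_wpmul2l// lee_fin powR_ge0.
  by rewrite leeD2l// lee_wpmul2l// lee_fin ltW.
rewrite -!EFinM -!EFinD lee_fin.
have -> : (T `^ (1 - r) * (q * (C * x) `^ r) = q * (4^-1 * x))%R.
  rewrite -KE /T !powRM ?(ltW K0) ?(ltW C0) ?(ltW x0)//.
  have xE : (x `^ (1 - r) * x `^ r = x)%R.
    by rewrite -powRD ?subrK ?powRr1 ?(ltW x0)// gt_eqF// implybT.
  transitivity (q * (K `^ (1 - r) * C `^ r * (x `^ (1 - r) * x `^ r)))%R; first by ring.
  by rewrite xE.
have -> : (m * q + T * (lam * q) + q * (4^-1 * x) = q * (m + K * lam * x + 4^-1 * x))%R.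
  by rewrite /T; ring.
rewrite ler_pM2l// => H.
have : (K * lam * x <= 4^-1 * x)%R by rewrite ler_pM2r.
lra.
Qed.

End level_control.

Section reverse_Jensen.
Context {R : realType}.
Variable w : plane R -> \bar R.
Hypothesis iw : (area R).-integrable (disc R) w.
Hypothesis w_fin : forall z, disc R z -> (0 < w z < +oo)%E.
Local Open Scope ereal_scope.

(** Let x be the mean of [w], and suppose x > m. On the square,
    log w <= log x + w / x - (log x - log m) 1_S, since log u <= log x + u / x
    everywhere while w <= m on S. Averaging,
    log x <= log C + log x + 1 - (log x - log m) / 2, which bounds x / m. *)
Lemma reverse_Jensen_level_control : reverse_Jensen w -> level_control w.
Proof.
move=> [_ [C [C0 HC]]]; exists (2^-1)%R; first by lra.
move=> b b0; pose E : R := expR (2 * (ln C + 1)).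
have E0 : (0 < E)%R by exact: expR_gt0.
exists ((1 + E) / b)%R; first by rewrite divr_gt0// addr_gt0.
move=> I S B m M arcI mQ Q0 mS SQ mB BQ m0 M0 wm wM Sl Bl.
have [q q0 qE] := carleson_area mQ Q0.
have mw := weight_measurable_carleson iw mQ.
have wEFin := weight_EFin_carleson w_fin.
have lowM : (b * M)%:E <= avg (carleson I) w.
  apply: (avg_lower_bound mQ q0 qE mw _ mB BQ _ wM Bl); last exact: ltW.
  exact: weight_ge0_carleson.
have [x [avgx intx]] := avg_weight iw mQ q0 qE.
rewrite avgx lee_fin in lowM.
have x0 : (0 < x)%R by apply: lt_le_trans lowM; rewrite mulr_gt0.
suff xm : (x <= (1 + E) * m)%R.
  rewrite mulrAC ler_pdivlMr// mulrC; exact: le_trans xm.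
have [xm|mx] := leP x m.
  by rewrite mulrDl mul1r (le_trans xm)// lerDl mulr_ge0// ltW.
suff xm : (x <= E * m)%R.
  by rewrite mulrDl mul1r (le_trans xm)// lerDr ltW.
have lnmx : (ln m < ln x)%R by rewrite ltr_ln.
pose d : R := (ln x - ln m)%R.
have d0 : (0 < d)%R by rewrite subr_gt0.
have [s [s1 sE]] : exists s : R, (2^-1 * q <= s)%R /\ area R S = s%:E.
  have Sfin : area R S \is a fin_num.
    rewrite ge0_fin_numE// (@le_lt_trans _ _ q%:E) ?ltry// -qE.
    by apply: le_measure; rewrite ?inE.
  exists (fine (area R S)); rewrite fineK//; split => //.
  rewrite -lee_fin fineK//; apply: le_trans Sl; rewrite qE -EFinM lee_fin; lra.
have mlog : measurable_fun (carleson I) (fun z => lne (w z)).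
  apply: (eq_measurable_fun (EFin \o (@ln R \o (fine \o w)))).
    move=> z; rewrite inE => Qz; have [u u0 zu] := wEFin _ _ Qz.
    by rewrite zu (lne_EFin u0) /= zu.
  apply/measurable_EFinP; apply: measurableT_comp => //.
  exact: (measurableT_comp _ mw).
have iQ := weight_integrable_carleson iw mQ.
have icst (c : R) : (area R).-integrable (carleson I) (cst c%:E).
  apply/integrableP; split; first exact: measurable_cst.
  apply: (@le_lt_trans _ _ (\int[area R]_(z in carleson I) (cst `|c|%:E) z)) => //.
  by rewrite integral_cst// qE -EFinM ltry.
have iwx : (area R).-integrable (carleson I) (fun z => (x^-1)%:E * w z).
  exact: integrableZl.
have i1 : (area R).-integrable (carleson I) (fun z => (\1_S z : R)%:E).
  apply: le_integrable (icst 1%R) => //; first exact/measurable_EFinP/measurable_indic.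
  by move=> z _; rewrite lee_fin indicE normr1; case: (_ \in _); rewrite ?normr1 ?normr0.
have iS : (area R).-integrable (carleson I) (fun z => (- d)%:E * (\1_S z)%:E).
  exact: integrableZl.
pose psi z : \bar R := (ln x)%:E + (x^-1)%:E * w z + (- d)%:E * (\1_S z)%:E.
have ipsi : (area R).-integrable (carleson I) psi.
  by apply: (integrableD mQ) iS; exact: (integrableD mQ (icst _) iwx).
have H : \int[area R]_(z in carleson I) lne (w z) <=
    (ln x * q + x^-1 * (q * x) + (- d) * s)%:E.
  have psiE : \int[area R]_(z in carleson I) psi z =
      (ln x * q + x^-1 * (q * x) + (- d) * s)%:E.
    transitivity (\int[area R]_(z in carleson I) (cst (ln x)%:E) z +
        \int[area R]_(z in carleson I) ((x^-1)%:E * w z) +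
        \int[area R]_(z in carleson I) ((- d)%:E * (\1_S z)%:E)).
      rewrite [LHS](integralD mQ (integrableD mQ (icst (ln x)) iwx) iS).
      by congr (_ + _); exact: (integralD mQ (icst (ln x)) iwx).
    rewrite integralZl// integralZl// integral_cst// integral_indic//.
    by rewrite setIidl// qE sE intx -!EFinM -!EFinD.
  rewrite -psiE.
  apply: le_integral_integrable_right => // z Qz.
  have [u u0 zu] := wEFin _ _ Qz.
  rewrite /psi zu lne_EFin// -!EFinM -!EFinD lee_fin indicE.
  have ux : (0 < x^-1 * u)%R by rewrite mulr_gt0// invr_gt0.
  have [Sz|nSz] := pselect (S z).
    rewrite mem_set// mulr1.
    have := wm _ Sz; rewrite zu lee_fin => um.
    have : (ln u <= ln m)%R by rewrite ler_ln.
    by rewrite /d; lra.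
  rewrite memNset// mulr0 addr0.
  have -> : ln u = (ln x + ln (x^-1 * u))%R.
    by rewrite -lnM ?posrE// mulrA divff ?gt_eqF// mul1r.
  by rewrite lerD2l ltW// ln_sublinear.
have : (avg (carleson I) (fun z => lne (w z))) <= (ln x + 1 - 2^-1 * d)%:E.
  rewrite (avgE qE) lee_pdivrMl//; apply: (le_trans H); rewrite -EFinM lee_fin.
  have -> : (x^-1 * (q * x) = q)%R by rewrite mulrCA mulVf ?mulr1// gt_eqF.
  have : (d * (2^-1 * q) <= d * s)%R by rewrite ler_pM2l.
  by lra.
rewrite -lee_expeR => {}H.
have {}H : (x <= C * expR (ln x + 1 - 2^-1 * d))%R.
  rewrite -lee_fin -avgx; apply: (le_trans (HC _ arcI)).
  by rewrite EFinM lee_pmul2l// lte_fin.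
have : (ln x <= ln C + (ln x + 1 - 2^-1 * d))%R.
  rewrite -[X in (_ <= _ + X)%R]expRK -lnM ?posrE ?expR_gt0// ler_ln ?posrE//.
  by rewrite mulr_gt0// expR_gt0.
rewrite /d => {}H.
have : (ln x <= 2 * (ln C + 1) + ln m)%R by lra.
rewrite -[X in (_ <= X + _)%R]expRK -/E -lnM ?posrE// ler_ln ?posrE//.
by rewrite mulr_gt0.
Qed.

End reverse_Jensen.

(** * Monotone profiles under level control *)

Lemma carleson_arc0 {R : realType} (t : R) : 0 < t <= 2^-1 ->
  carleson (arc 0 (2 * pi * t)) = sector 0 (2 * pi * t) `&` annulus (1 - t) 1.
Proof.
move=> /andP[t0 t1]; have pi0 := @pi_gt0 R.
have tpi : 2 * pi * t <= pi.
  by rewrite mulrAC ler_piMl ?(ltW pi0)//; lra.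
rewrite carleson_arc ?add0r ?mulr_gt0//.
by rewrite (mulrC _ t) mulfK// gt_eqF// mulr_gt0.
Qed.

Section monotone_profile.
Context {R : realType}.
Variables (w : plane R -> \bar R) (v : R -> R).
Hypothesis wv : forall z, disc R z -> w z = (v (cmod z))%:E.
Hypothesis v0 : forall r : R, 0 <= r < 1 -> 0 < v r.
Hypothesis lcw : level_control w.

(** [level_control] for subsets bounded by circles, in which case the factor
    [wedge] cancels from all areas. *)
Lemma level_control_carleson : exists2 lam : R, 0 < lam < 1 &
  forall b : R, 0 < b -> exists2 C : R, 0 < C & forall t r1 r2 r3 r4 m M : R,
    0 < t <= 2^-1 -> 1 - t <= r1 -> r1 < r2 -> r2 <= 1 ->
    1 - t <= r3 -> r3 < r4 -> r4 <= 1 -> 0 < m -> 0 < M ->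
    (forall r, r1 < r < r2 -> v r <= m) -> (forall r, r3 < r < r4 -> M <= v r) ->
    (1 - lam) * (1 - (1 - t) ^+ 2) <= r2 ^+ 2 - r1 ^+ 2 ->
    b * (1 - (1 - t) ^+ 2) <= r4 ^+ 2 - r3 ^+ 2 ->
    M <= C * m.
Proof.
have [lam lam01 H] := lcw; exists lam => // b b0.
have [C C0 {}H] := H b b0; exists C => //.
move=> t r1 r2 r3 r4 m M t01 tr1 r12 r21 tr3 r34 r41 m0 M0 vm vM Hm HM.
have pi0 := @pi_gt0 R.
have s0 : 0 < 2 * pi * t <= pi.
  have /andP[t0 t1] := t01.
  by rewrite !mulr_gt0//= mulrAC ler_piMl ?(ltW pi0)//; lra.
have D0 := wedge_gt0 s0.
have QE := carleson_arc0 t01.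
have sub q1 q2 : 1 - t <= q1 -> q2 <= 1 ->
    sector 0 (2 * pi * t) `&` annulus q1 q2 `<=` carleson (arc 0 (2 * pi * t)).
  rewrite QE => tq q1' z [zs /andP[z1 z2]]; split => //; apply/andP; split.
    exact: le_lt_trans z1.
  exact: lt_le_trans q1'.
have aE q1 q2 : 1 - t <= q1 -> q1 <= q2 ->
    area R (sector 0 (2 * pi * t) `&` annulus q1 q2) =
    ((q2 ^+ 2 - q1 ^+ 2) * wedge (2 * pi * t))%:E.
  by move=> tq1 q12; rewrite area_sector_annulus//; lra.
have aQ : area R (carleson (arc 0 (2 * pi * t))) =
    ((1 - (1 - t) ^+ 2) * wedge (2 * pi * t))%:E.
  by rewrite QE aE ?expr1n//; lra.
apply: (H (arc 0 (2 * pi * t)) (sector 0 (2 * pi * t) `&` annulus r1 r2)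
  (sector 0 (2 * pi * t) `&` annulus r3 r4)) => //.
- by apply: is_arc_arc; rewrite ?add0r//; case/andP: s0.
- by rewrite QE; exact: measurable_sector_annulus.
- by rewrite aQ lte_fin mulr_gt0// subr_gt0 expr_lt1//; lra.
- exact: measurable_sector_annulus.
- exact: sub.
- exact: measurable_sector_annulus.
- exact: sub.
- move=> z [zs /andP[z1 z2]]; rewrite wv ?lee_fin ?vm ?z1//.
  exact: lt_le_trans r21.
- move=> z [zs /andP[z1 z2]]; rewrite wv ?lee_fin ?vM ?z1//.
  exact: lt_le_trans r41.
- by rewrite aQ aE ?(ltW r12)// -EFinM lee_fin mulrA ler_pM2r.
- by rewrite aQ aE ?(ltW r34)// -EFinM lee_fin mulrA ler_pM2r.
Qed.

(** The strip of height h occupies less than the proportion lam of the square of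
    side N h, because lam N = 2. *)
Lemma increasing_level_control :
  (forall r s : R, 0 <= r -> r <= s -> s < 1 -> v r <= v s) ->
  exists h0 C : R, [/\ 0 < h0 <= 2^-1, 0 < C &
    forall h : R, 0 < h <= h0 -> v (1 - h / 2) <= C * v (1 - h)].
Proof.
move=> iv; have [lam /andP[l0 l1] H] := level_control_carleson.
pose N := 2 / lam.
have N0 : 0 < N by rewrite divr_gt0.
have N2 : 2 <= N by rewrite ler_pdivlMr// ler_piMr// ltW.
have lN : lam * N = 2 by rewrite mulrC divfK// gt_eqF.
clearbody N.
have b0 : 0 < (4 * N)^-1 by rewrite invr_gt0 mulr_gt0.
have [C C0 {}H] := H _ b0.
exists (2 * N)^-1, C; split => //.
  by rewrite invr_gt0 mulr_gt0//= lef_pV2 ?posrE ?mulr_gt0//; lra.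
move=> h /andP[h_gt0 hN].
have Nh : N * h <= 2^-1.
  move: hN; rewrite -(@ler_pM2l _ N)// invfM mulrCA divff ?gt_eqF// mulr1.
  by [].
have Nh0 : 0 < N * h by rewrite mulr_gt0.
have hNh : 2 * h <= N * h by rewrite ler_pM2r.
have lNh : lam * (N * h) = 2 * h by rewrite mulrA lN.
have bNh : (4 * N)^-1 * (N * h) = h / 4.
  by field; rewrite gt_eqF.
apply: (H (N * h) (1 - N * h) (1 - h) (1 - h / 2) 1) => //; try lra.
- by apply: v0; lra.
- by apply: v0; lra.
- by move=> r /andP[r1 r2]; apply: iv; lra.
- by move=> r /andP[r1 r2]; apply: iv; lra.
- set t := N * h in Nh Nh0 hNh lNh *.
  have : lam * t * t = 2 * h * t by rewrite lNh.
  by rewrite !expr2; nra.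
- set t := N * h in Nh Nh0 hNh lNh bNh *.
  set k := (4 * N)^-1 in bNh *.
  have : k * t * t = h / 4 * t by rewrite bNh.
  by rewrite !expr2; nra.
Qed.

Lemma exists_expr_le_half (x : R) : 0 < x < 1 -> exists k, x ^+ k <= 2^-1.
Proof.
move=> /andP[x0 x1].
have /cvgrPdist_le/(_ 2^-1) : (fun n => x ^+ n) @ \oo --> (0 : R).
  by apply: cvg_expr; rewrite ger0_norm// ltW.
rewrite invr_gt0 ltr0n => /(_ isT) [k _ /(_ k (leqnn k))].
by rewrite /= sub0r normrN ger0_norm ?exprn_ge0 ?(ltW x0)// => xk; exists k.
Qed.

(** In the square of side t, leave out of S the heights between (1 - lam) t and t,
    and let B be the upper half of this layer. This compares v at the heights
    kap t and (1 - lam) t, whose ratio rho is less than 1; finitely many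
    iterations reach the ratio 1 / 2. *)
Lemma decreasing_level_control :
  (forall r s : R, 0 <= r -> r <= s -> s < 1 -> v s <= v r) ->
  exists h0 C : R, [/\ 0 < h0 <= 2^-1, 0 < C &
    forall h : R, 0 < h <= h0 -> v (1 - h) <= C * v (1 - h / 2)].
Proof.
move=> dv; have [lam /andP[l0 l1] H] := level_control_carleson.
have b0 : 0 < lam / 4 by rewrite divr_gt0.
have [C C0 {}H] := H _ b0.
pose kap := 1 - lam / 2; pose rho := (1 - lam) / kap.
have kap0 : 0 < kap by rewrite /kap; lra.
have rho0 : 0 < rho by rewrite divr_gt0// subr_gt0.
have rho1 : rho < 1 by rewrite ltr_pdivrMr// mul1r /kap; lra.
have step h : 0 < h <= 4^-1 -> v (1 - h) <= C * v (1 - rho * h).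
  move=> /andP[h0 h1].
  pose t := h / kap.
  have hE : h = kap * t by rewrite /t mulrC divfK// gt_eqF.
  have t0 : 0 < t by rewrite divr_gt0.
  have t1 : t <= 2^-1 by rewrite ler_pdivrMr// /kap; lra.
  have -> : rho * h = (1 - lam) * t by rewrite /rho /t mulrAC -mulrA.
  have lt0 : 0 < lam * t by rewrite mulr_gt0.
  have lt1 : lam * t < t by rewrite gtr_pMl.
  have e1 : (1 - lam) * t = t - lam * t by ring.
  have e2 : kap * t = t - lam * t / 2 by rewrite /kap; ring.
  rewrite hE e1 e2.
  apply: (H t (1 - (t - lam * t)) 1 (1 - t) (1 - (t - lam * t / 2))) => //; try lra.
  - by apply: v0; lra.
  - by apply: v0; lra.
  - by move=> r /andP[r1 r2]; apply: dv; lra.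
  - by move=> r /andP[r1 r2]; apply: dv; lra.
  - by rewrite !expr2; nra.
  - by rewrite !expr2; nra.
have [|k rk] := @exists_expr_le_half rho; first by rewrite rho0.
exists 4^-1, (C ^+ k); split; [lra|exact: exprn_gt0|].
move=> h /andP[h0 h1].
have iter j : v (1 - h) <= C ^+ j * v (1 - rho ^+ j * h).
  elim: j => [|j IH]; first by rewrite !expr0 !mul1r.
  apply: (le_trans IH); rewrite exprSr -mulrA ler_pM2l ?exprn_gt0//.
  rewrite exprS -mulrA; apply: step; rewrite mulr_gt0 ?exprn_gt0//=.
  by apply: le_trans h1; rewrite ler_piMl ?(ltW h0)// exprn_ile1// ltW.
apply: (le_trans (iter k)); rewrite ler_pM2l ?exprn_gt0//.
have rkh : rho ^+ k * h <= h / 2.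
  by rewrite [leRHS]mulrC ler_pM2r.
have rkh0 : 0 < rho ^+ k * h by rewrite mulr_gt0// exprn_gt0.
by apply: dv; lra.
Qed.

End monotone_profile.

(** * The maximal function of an increasing weight *)

Section lower_bounds.
Local Open Scope ereal_scope.
Context d (T : measurableType d) (R : realType).
Variable mu : {measure set T -> \bar R}.

(** Monotonicity holds without measurability, the integral of a nonnegative
    function being a supremum over the simple functions below it. This spares
    the measurability of the maximal function, a supremum of an uncountable
    family. *)
Lemma ge0_le_integral_nonmeasurable (D : set T) (f g : T -> \bar R) :
  (forall x, D x -> 0 <= f x) -> (forall x, D x -> f x <= g x) ->
  \int[mu]_(x in D) f x <= \int[mu]_(x in D) g x.
Proof.
move=> f0 fg; have g0 x : D x -> 0 <= g x.
  by move=> Dx; exact: le_trans (f0 _ Dx) (fg _ Dx).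
rewrite ge0_integralE// [leRHS]ge0_integralE//; apply: ereal_sup_le.
move=> _ [h /= hf <-]; exists h => //= x; apply: (le_trans (hf x)).
exact: lee_restrict.
Qed.

Lemma sum_le_integral (D : set T) (g : T -> \bar R) n (A : nat -> set T)
    (c : nat -> R) :
  measurable D -> (forall x, D x -> 0 <= g x) ->
  (forall k, (k < n)%N -> measurable (A k) /\ A k `<=` D) ->
  (forall k l x, (k < n)%N -> (l < n)%N -> A k x -> A l x -> k = l) ->
  (forall k, (k < n)%N -> (0 <= c k)%R) ->
  (forall k x, (k < n)%N -> A k x -> (c k)%:E <= g x) ->
  \sum_(k < n) (c k)%:E * mu (A k) <= \int[mu]_(x in D) g x.
Proof.
move=> mD g0 mA tA c0 cg.
pose phi x := \sum_(k < n) (c k)%:E * (\1_(A k) x)%:E.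
apply: (@le_trans _ _ (\int[mu]_(x in D) phi x)); last first.
  apply: ge0_le_integral_nonmeasurable => x Dx.
    by apply: sume_ge0 => k _; rewrite mule_ge0 ?lee_fin ?c0 ?ltn_ord.
  have [[k Akx]|nA] := pselect (exists k : 'I_n, A k x).
    rewrite /phi (bigD1 k)//= big1.
      by rewrite adde0 indicE mem_set// mule1 cg.
    move=> l lk; rewrite indicE memNset ?mule0// => Alx.
    move/eqP: lk; apply; apply: val_inj => /=.
    exact: (tA _ _ x (ltn_ord l) (ltn_ord k)).
  rewrite /phi big1 ?g0// => k _; rewrite indicE memNset ?mule0// => Akx.
  by apply: nA; exists k.
rewrite /phi ge0_integral_sum//; last 2 first.
- move=> k; apply: emeasurable_funM => //; apply/measurable_EFinP.
  by apply: measurable_indic; have [] := mA k (ltn_ord k).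
- by move=> k x _; rewrite mule_ge0 ?lee_fin ?c0 ?ltn_ord.
apply: lee_sum => k _; have [mAk AD] := mA k (ltn_ord k).
rewrite (ge0_integralZl_EFin _ _ _ _ (c0 _ (ltn_ord k)))//; last first.
  by apply/measurable_EFinP/measurable_indic.
by rewrite integral_indic// setIidl.
Qed.

End lower_bounds.

Section Binfty_increasing.
Context {R : realType}.
Variables (w : plane R -> \bar R) (v : R -> R).
Hypothesis wv : forall z, disc R z -> w z = (v (cmod z))%:E.
Hypothesis v0 : forall r : R, 0 <= r < 1 -> 0 < v r.
Hypothesis iv : forall r s : R, 0 <= r -> r <= s -> s < 1 -> v r <= v s.
Hypothesis iw : (area R).-integrable (disc R) w.

Variables (n : nat) (h : R).
Hypotheses (h_gt0 : 0 < h) (h_le : 2 ^+ n * h <= 2^-1).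

(* th is the angle of an arc of normalized length h, Q the square of side
   2 ^+ n * h, and V the mass near the circle of the square of side h. *)
Local Notation th := (2 * pi * h).
Local Notation Q := (carleson (arc 0 (2 ^+ n * th))).
Local Notation V :=
  (fine (\int[area R]_(z in sector 0 th `&` annulus (1 - h) 1) w z)).
Local Notation D := (wedge th).

Let pow_gt0 k : 0 < 2 ^+ k :> R. Proof. exact: exprn_gt0. Qed.

Let scale_le k : (k <= n)%N -> 2 ^+ k * h <= 2^-1.
Proof.
move=> kn; apply: le_trans h_le; rewrite ler_pM2r//.
by rewrite ler_weXn2l// ler1n.
Qed.

Let angle_gt0 k : 0 < 2 ^+ k * th. Proof. by rewrite !mulr_gt0// pi_gt0. Qed.

Let angle_le k : (k <= n)%N -> 2 ^+ k * th <= pi.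
Proof.
move=> kn; have := scale_le kn; have pi0 := @pi_gt0 R.
rewrite -(ler_pM2l (_ : 0 < 2 * pi)) ?mulr_gt0// mulrCA => /le_trans; apply.
by rewrite mulrAC divff// mul1r.
Qed.

Let angleE k : 2 ^+ k * th = 2 * pi * (2 ^+ k * h). Proof. by ring. Qed.

Let th_itv : 0 < th <= pi.
Proof.
by have := angle_gt0 0; have := angle_le (leq0n n); rewrite expr0 mul1r => -> ->.
Qed.

Let D_gt0 : 0 < D. Proof. exact: wedge_gt0. Qed.

Let square k : (k <= n)%N ->
  carleson (arc 0 (2 ^+ k * th)) =
  sector 0 (2 ^+ k * th) `&` annulus (1 - 2 ^+ k * h) 1.
Proof.
move=> kn; rewrite angleE carleson_arc0//.
by rewrite scale_le// andbT mulr_gt0.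
Qed.

Let w_measurable r1 : measurable_fun (annulus r1 1) w.
Proof.
have /integrableP[mw _] := iw; apply: measurable_funS mw; first exact: measurable_disc.
by move=> z /andP[].
Qed.

Let w_ge0 z : disc R z -> (0 <= w z)%E.
Proof.
by move=> z1; rewrite wv// lee_fin ltW// v0// cmod_ge0.
Qed.

Let tip_measurable s : 0 < s <= pi -> measurable (sector 0 s `&` annulus (1 - h) 1).
Proof. exact: measurable_sector_annulus. Qed.

Let VE : (\int[area R]_(z in sector 0 th `&` annulus (1 - h) 1) w z = V%:E)%E.
Proof.
rewrite fineK//; apply: integrable_fin_num; first exact: tip_measurable.
apply: (integrableS measurable_disc) iw; first exact: tip_measurable.
by move=> z [_ /andP[]].
Qed.

Let tip_integral a k : 0 <= a -> (k <= n)%N -> a + 2 ^+ k * th <= pi ->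
  (\int[area R]_(z in sector a (2 ^+ k * th)%R `&` annulus (1 - h)%R 1%R) w z =
   (2 ^+ k * V)%:E)%E.
Proof.
move=> a0 kn api; have pi0 := @pi_gt0 R.
have k0 := angle_gt0 k.
have wr z z' : annulus (1 - h) 1 z -> cmod z = cmod z' -> w z = w z'.
  by move=> /andP[_ z1] zz'; rewrite !wv// /disc/= -?zz'.
have wp z : annulus (1 - h) 1 z -> (0 <= w z)%E by move=> /andP[_]; exact: w_ge0.
have aI : - pi < a < pi.
  by rewrite (lt_le_trans _ a0) ?oppr_lt0//= (lt_le_trans _ api)// ltrDl.
have kI : 0 < 2 ^+ k * th <= pi by rewrite k0 angle_le.
rewrite (integral_sector_rot (@w_measurable (1 - h)) wp wr aI kI).
have /andP[th0 _] := th_itv.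
rewrite (integral_sector_pow2 (@w_measurable (1 - h)) wp wr th0 (angle_le kn)).
by rewrite VE -EFinM.
Qed.

Let tip_lower : v (1 - h / 2) * (h / 2 * D) <= V.
Proof.
have h1 : h <= 2^-1 by have := scale_le (leq0n n); rewrite expr0 mul1r.
have [e0 e1 e2] : [/\ 0 < 1 - h / 2, 1 - h / 2 < 1 & 1 - h < 1 - h / 2].
  by move: (h) (h_gt0) h1 => y *; split; lra.
have e3 : h / 2 <= 1 ^+ 2 - (1 - h / 2) ^+ 2.
  by rewrite !expr2; move: (h) (h_gt0) h1 => y *; nra.
have v1 : 0 < v (1 - h / 2) by apply: v0; rewrite ltW.
apply: (@le_trans _ _ (v (1 - h / 2) * ((1 ^+ 2 - (1 - h / 2) ^+ 2) * D))).
  by rewrite ler_pM2l// ler_pM2r.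
rewrite -lee_fin -VE EFinM -area_sector_annulus ?(ltW e1)//.
have mt : measurable (sector 0 th `&` annulus (1 - h / 2) 1).
  exact: measurable_sector_annulus.
apply: (@le_trans _ _ (\int[area R]_(z in sector 0 th `&` annulus (1 - h / 2) 1) w z)%E).
  rewrite -integral_cst//; apply: ge0_le_integral_nonmeasurable.
    by move=> z _; rewrite lee_fin ltW.
  move=> z [_ /andP[z1 z2]]; rewrite wv// lee_fin.
  by apply: iv; rewrite ?(ltW e0) ?(ltW z1).
apply: ge0_subset_integral => //.
- exact: tip_measurable.
- apply: measurable_funS (@w_measurable (1 - h)); first exact: measurable_annulus.
  by move=> z [].
- by move=> z [_ /andP[_]]; exact: w_ge0.
- move=> z [zs /andP[z1 z2]]; split => //; apply/andP; split => //.
  exact: lt_trans z1.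
Qed.

(* The layer of heights between 2^k h and 2^(k+1) h. *)
Let layer k := sector 0 (2 ^+ n * th) `&`
  annulus (1 - 2 ^+ k.+1 * h) (1 - 2 ^+ k * h).

(* The mass 2^(k+1) V over the area of the square of side 2^(k+1) h. *)
Let level k := V / (D * (1 - (1 - 2 ^+ k.+1 * h) ^+ 2)).

Let maxfun_level k z : (k < n)%N -> layer k z ->
  ((level k)%:E <= maxfun (w \_ Q) z)%E.
Proof.
move=> kn [[z0 [t]] /=]; rewrite in_itv/= add0r => /andP[t0 tn] tz /andP[z1 z2].
pose s := 2 ^+ k.+1 * th.
(* The arc of angle s starts at the direction of z, unless it would then leave
   the arc of Q. *)
pose a := Num.min t (2 ^+ n * th - s).
have sn : s <= 2 ^+ n * th by rewrite ler_pM2r ?ler_weXn2l ?ler1n//; case/andP: th_itv.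
have a0 : 0 <= a by rewrite le_min t0 subr_ge0.
have an : a + s <= 2 ^+ n * th by rewrite -lerBrDr ge_min lexx orbT.
have apis : a + s <= pi by rewrite (le_trans an)// angle_le.
have at_ : a <= t by rewrite ge_min lexx.
have ts : t < a + s.
  rewrite /a; case: (leP t (2 ^+ n * th - s)) => _; first by rewrite ltrDl angle_gt0.
  by rewrite subrK.
have s0 : 0 < s := angle_gt0 _.
have spi : 0 < s <= pi by rewrite s0 angle_le.
have Js : carleson (arc a s) = sector a s `&` annulus (1 - 2 ^+ k.+1 * h) 1.
  rewrite carleson_arc// /s angleE.
  by rewrite (mulrC _ (2 ^+ k.+1 * h)) mulfK// gt_eqF// mulr_gt0// pi_gt0.
have h1 := scale_le kn.
have k0 : 0 < 2 ^+ k.+1 * h by rewrite mulr_gt0.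
have c0 : 0 < 1 - (1 - 2 ^+ k.+1 * h) ^+ 2.
  by rewrite subr_gt0 expr_lt1//; move: (2 ^+ k.+1 * h) k0 h1 => y *; lra.
have JQ : carleson (arc a s) `<=` Q.
  rewrite Js square// => u [[u0 [t' /=]]].
  rewrite in_itv/= => /andP[at' t's] t'u /andP[u1 u2]; split.
    split => //; exists t' => //; rewrite /= in_itv/= add0r.
    by rewrite (le_trans a0 at') (lt_le_trans t's an).
  apply/andP; split => //; apply: le_lt_trans u1; rewrite lerD2l lerN2 ler_pM2r//.
  by rewrite ler_weXn2l ?ler1n.
have mJ : measurable (carleson (arc a s)) by rewrite Js; exact: measurable_sector_annulus.
have aJ : area R (carleson (arc a s)) =
    ((1 - (1 - 2 ^+ k.+1 * h) ^+ 2) * (2 ^+ k.+1 * D))%:E.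
  rewrite Js area_sector_rot ?spi//; last first.
    rewrite (lt_le_trans _ a0) ?oppr_lt0 ?pi_gt0//= (lt_le_trans _ apis)//.
    by rewrite ltrDl.
  have [r0 r1] : 0 < 1 - 2 ^+ k.+1 * h /\ 1 - 2 ^+ k.+1 * h <= 1.
    by move: (2 ^+ k.+1 * h) k0 h1 => y *; split; lra.
  rewrite area_sector_annulus//.
  by rewrite expr1n wedge_pow2// ?angle_le//; case/andP: th_itv.
apply: (@le_trans _ _ (avg (carleson (arc a s)) (fun u => `|(w \_ Q) u|)%E)); last first.
  apply: ereal_sup_ubound; exists (arc a s); split => //; first exact: is_arc_arc.
  rewrite Js; split; last first.
    by apply/andP; split => //; apply: (lt_trans z2); rewrite gtrBl mulr_gt0.
  by split => //; exists t; rewrite //= in_itv/= at_.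
have q0 : 0 < (1 - (1 - 2 ^+ k.+1 * h) ^+ 2) * (2 ^+ k.+1 * D).
  by rewrite !mulr_gt0.
rewrite (avgE aJ) lee_pdivlMl// -EFinM.
have -> : (1 - (1 - 2 ^+ k.+1 * h) ^+ 2) * (2 ^+ k.+1 * D) * level k = 2 ^+ k.+1 * V.
  by rewrite /level; field; rewrite !gt_eqF.
rewrite -(tip_integral a0 kn apis).
have -> : (\int[area R]_(u in carleson (arc a s)) `|(w \_ Q) u| =
    \int[area R]_(u in carleson (arc a s)) w u)%E.
  apply: eq_integral => u; rewrite inE => Ju.
  rewrite patchT; last by rewrite inE; exact: JQ.
  by rewrite gee0_abs// w_ge0//; case: Ju.
apply: ge0_subset_integral => //.
- exact: measurable_sector_annulus.
- exact: weight_measurable_carleson.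
- by move=> u [u1 _ _ _]; exact: w_ge0.
- rewrite Js => u [us /andP[u1 u2]]; split => //; apply/andP; split => //.
  apply: le_lt_trans u1; rewrite lerD2l lerN2 ler_peMl ?(ltW h_gt0)//.
  by rewrite exprn_ege1// ler1n.
Qed.

Let maxfun_ge0 z : Q z -> (0 <= maxfun (w \_ Q) z)%E.
Proof.
move=> Qz; apply: (@le_trans _ _ (avg Q (fun u => `|(w \_ Q) u|)%E)).
  by rewrite /avg mule_ge0 ?integral_ge0// lee_fin invr_ge0 fine_ge0.
apply: ereal_sup_ubound; exists (arc 0 (2 ^+ n * th)); split => //.
by apply: is_arc_arc; rewrite ?add0r ?angle_gt0 ?angle_le.
Qed.

Let integral_maxfun_lower :
  ((n%:R / 4 * (2 ^+ n * V))%:E <= \int[area R]_(z in Q) maxfun (w \_ Q) z)%E.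
Proof.
have sn : 0 < 2 ^+ n * th <= pi by rewrite angle_gt0 angle_le.
have V0 : 0 <= V by rewrite fine_ge0// integral_ge0// => z [_ /andP[_]]; exact: w_ge0.
apply: (@le_trans _ _ (\sum_(k < n) (level k)%:E * area R (layer k))%E).
  apply: (@le_trans _ _ (\sum_(k < n) (4^-1 * (2 ^+ n * V))%:E)%E).
    rewrite sumEFin lee_fin sumr_const card_ord -mulr_natl -mulrA.
    by rewrite le_eqVlt; apply/orP; left; apply/eqP; ring.
  apply: lee_sum => k _; have kn := ltn_ord k.
  have h1 := scale_le kn.
  have k0 : 0 < 2 ^+ k * h by rewrite mulr_gt0.
  have e : 2 ^+ k.+1 * h = 2 * (2 ^+ k * h) by rewrite exprS mulrA.
  have [r0 r1] : 0 < 1 - 2 ^+ k.+1 * h /\ 1 - 2 ^+ k.+1 * h <= 1 - 2 ^+ k * h.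
    by move: h1; rewrite e; move: (2 ^+ k * h) k0 => y *; split; lra.
  rewrite /layer area_sector_annulus//.
  rewrite wedge_pow2 ?angle_le//; last by case/andP: th_itv.
  rewrite -EFinM lee_fin /level e.
  move: h1; rewrite e; set x := 2 ^+ k * h in k0 *; move=> h1.
  have c0 : 0 < 1 - (1 - 2 * x) ^+ 2 by rewrite !expr2; nra.
  have -> : V / (D * (1 - (1 - 2 * x) ^+ 2)) *
      (((1 - x) ^+ 2 - (1 - 2 * x) ^+ 2) * (2 ^+ n * D)) =
      ((1 - x) ^+ 2 - (1 - 2 * x) ^+ 2) / (1 - (1 - 2 * x) ^+ 2) * (2 ^+ n * V).
    by field; rewrite !gt_eqF.
  apply: ler_wpM2r; first by rewrite mulr_ge0// ltW.
  (* For x <= 1/4, ((1 - x)^2 - (1 - 2x)^2) / (1 - (1 - 2x)^2) is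
     (2 - 3x) / (4 - 4x) >= 1/4. *)
  by rewrite ler_pdivlMr// !expr2; nra.
apply: sum_le_integral.
- by rewrite square//; exact: measurable_sector_annulus.
- exact: maxfun_ge0.
- move=> k kn; split; first exact: measurable_sector_annulus.
  rewrite square// => z [zs /andP[z1 z2]]; split => //; apply/andP; split.
    apply: le_lt_trans z1; rewrite lerD2l lerN2 ler_pM2r//.
    by rewrite ler_weXn2l ?ler1n.
  by apply: (lt_trans z2); rewrite gtrBl mulr_gt0.
- have key k l z : (k < l)%N -> layer k z -> layer l z -> False.
    move=> kl [_ /andP[z1 _]] [_ /andP[_ z2]].
    have : 2 ^+ k.+1 * h <= 2 ^+ l * h by rewrite ler_pM2r// ler_weXn2l ?ler1n.
    by move: (2 ^+ k.+1 * h) (2 ^+ l * h) z1 z2 => y y' *; lra.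
  move=> k l z _ _ zk zl; case: (ltngtP k l) => // kl.
    by have := key _ _ _ kl zk zl.
  by have := key _ _ _ kl zl zk.
- move=> k kn; have h1 := scale_le kn.
  have k0 : 0 < 2 ^+ k.+1 * h by rewrite mulr_gt0.
  by rewrite divr_ge0// mulr_ge0 ?(ltW D_gt0)// subr_ge0 expr_le1//;
    move: (2 ^+ k.+1 * h) k0 h1 => y *; lra.
- exact: maxfun_level.
Qed.

(* Below the strip of height h the weight is at most v (1 - h). *)
Let integral_weight_upper :
  (\int[area R]_(z in Q) w z <=
   (2 ^+ n * V + v (1 - h)%R * ((1 - (1 - 2 ^+ n * h) ^+ 2) * (2 ^+ n * D)))%:E)%E.
Proof.
have sn : 0 < 2 ^+ n * th <= pi by rewrite angle_gt0 angle_le.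
have x0 : 0 < 2 ^+ n * h by rewrite mulr_gt0.
have hx : h <= 2 ^+ n * h by rewrite ler_peMl ?(ltW h_gt0)// exprn_ege1// ler1n.
pose A := sector 0 (2 ^+ n * th) `&` annulus (1 - h) 1.
have mA : measurable A by exact: measurable_sector_annulus.
have QE : Q = sector 0 (2 ^+ n * th) `&` annulus (1 - 2 ^+ n * h) 1 by rewrite square.
have mQ : measurable Q by rewrite QE; exact: measurable_sector_annulus.
have AQ : A `<=` Q.
  rewrite QE => z [zs /andP[z1 z2]]; split => //; apply/andP; split => //.
  by apply: le_lt_trans z1; rewrite lerD2l lerN2.
have mw := weight_measurable_carleson iw mQ.
have wQ0 z : Q z -> (0 <= w z)%E by move=> [z1 _ _ _]; exact: w_ge0.
have mQA : measurable (Q `\` A) by exact: measurableD.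
have vh0 : 0 < v (1 - h).
  by apply: v0; move: (h) (2 ^+ n * h) (h_gt0) hx (h_le) => y y' *; lra.
have -> : Q = A `|` (Q `\` A) by rewrite setDUK.
rewrite ge0_integral_setU ?setDUK//; last first.
  by apply/disj_setPS => z [Az []].
rewrite EFinD -(tip_integral (lexx 0)) ?add0r ?angle_le//; apply: leeD => //.
apply: (@le_trans _ _ (\int[area R]_(z in Q `\` A) (cst (v (1 - h))%:E) z)%E).
  apply: ge0_le_integral_nonmeasurable => z [Qz nAz]; first exact: wQ0.
  have [z1 z0 za _] := Qz; rewrite wv// lee_fin; apply: iv; first exact: cmod_ge0.
    rewrite leNgt; apply/negP => hz; apply: nAz; split; last by apply/andP.
    by move: Qz; rewrite QE => -[].
  by rewrite gtrBl.
rewrite integral_cst// EFinM lee_pmul2l ?lte_fin//.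
have [r0 r1] : 0 < 1 - 2 ^+ n * h /\ 1 - 2 ^+ n * h <= 1.
  by move: (2 ^+ n * h) x0 (h_le) => y *; split; lra.
rewrite -wedge_pow2 ?angle_le//; last by case/andP: th_itv.
rewrite -[X in (X - _)%R](expr1n _ 2) -area_sector_annulus// -QE.
by apply: le_measure; rewrite ?inE//; exact: subDsetl.
Qed.

(** The n layers contribute n / 4 times 2^n V on the left. On the right, C 2^n V is
    absorbed, leaving a multiple of v (1 - h) times the area of the square. *)
Lemma Binfty_square_bound (C : R) : 0 < C -> C + 1 <= n%:R / 4 ->
  (\int[area R]_(z in Q) maxfun (w \_ Q) z <= C%:E * \int[area R]_(z in Q) w z)%E ->
  v (1 - h / 2) <= 4 * C * 2 ^+ n * v (1 - h).
Proof.
move=> C0 Cn HB.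
have x0 : 0 < 2 ^+ n * h by rewrite mulr_gt0.
have hx : h <= 2 ^+ n * h by rewrite ler_peMl ?(ltW h_gt0)// exprn_ege1// ler1n.
have vh0 : 0 < v (1 - h).
  by apply: v0; move: (h) (2 ^+ n * h) (h_gt0) hx (h_le) => y y' *; lra.
have V0 : 0 <= V by rewrite fine_ge0// integral_ge0// => z [_ /andP[_]]; exact: w_ge0.
have := le_trans integral_maxfun_lower HB.
have CE0 : (0 <= C%:E)%E by rewrite lee_fin ltW.
move=> /le_trans => /(_ _ (lee_wpmul2l CE0 integral_weight_upper)).
rewrite -EFinM lee_fin => main.
rewrite -(ler_pM2r (_ : 0 < h / 2 * D)); last by rewrite !mulr_gt0// invr_gt0.
apply: (le_trans tip_lower).
have P0 := pow_gt0 n.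
move: main x0; set P := 2 ^+ n in P0 *; set m := v (1 - h) in vh0 *.
set d := D; set V' := V in V0 *; have d0 : 0 < d := D_gt0.
move: (n%:R) Cn (h) (h_gt0) => N Cn y y0 main x0.
have main' : N / 4 * V' <= C * (V' + m * ((1 - (1 - P * y) ^+ 2) * d)).
  rewrite -(ler_pM2l P0).
  have -> : P * (N / 4 * V') = N / 4 * (P * V') by ring.
  apply: (le_trans main); rewrite le_eqVlt; apply/orP; left; apply/eqP; ring.
have : (C + 1) * V' <= N / 4 * V' by rewrite ler_wpM2r.
have : C * (m * ((1 - (1 - P * y) ^+ 2) * d)) <= C * (m * ((2 * (P * y)) * d)).
  rewrite !ler_pM2l// ler_pM2r//.
  have := sqr_ge0 (P * y); rewrite !expr2; lra.
have -> : 4 * C * P * m * (y / 2 * d) = C * (m * (2 * (P * y) * d)) by field.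
lra.
Qed.

End Binfty_increasing.

Lemma increasing_Binfty {R : realType} (w : plane R -> \bar R) (v : R -> R) :
  (forall z, disc R z -> w z = (v (cmod z))%:E) ->
  (forall r : R, 0 <= r < 1 -> 0 < v r) ->
  (forall r s : R, 0 <= r -> r <= s -> s < 1 -> v r <= v s) ->
  Binfty w ->
  exists h0 C : R, [/\ 0 < h0 <= 2^-1, 0 < C &
    forall h : R, 0 < h <= h0 -> v (1 - h / 2) <= C * v (1 - h)].
Proof.
move=> wv v0 iv [iw [C [C0 HC]]].
pose n := Num.bound (4 * (C + 1)).
have Cn : C + 1 <= n%:R / 4.
  rewrite ler_pdivlMr// mulrC ltW// archi_boundP//.
  by rewrite mulr_ge0// addr_ge0// ltW.
have P0 : 0 < 2 ^+ n :> R by exact: exprn_gt0.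
exists (2 * 2 ^+ n)^-1, (4 * C * 2 ^+ n); split.
- rewrite invr_gt0 mulr_gt0//= lef_pV2 ?posrE ?mulr_gt0//.
  by rewrite ler_peMr// exprn_ege1// ler1n.
- by rewrite !mulr_gt0.
move=> h /andP[h0 h1].
have hle : 2 ^+ n * h <= 2^-1.
  by rewrite -ler_pdivlMl// -invfM mulrC.
apply: (Binfty_square_bound wv v0 iv iw h0 hle C0 Cn).
apply: HC; apply: is_arc_arc => //; first by rewrite !mulr_gt0// pi_gt0.
rewrite add0r; have := hle; rewrite -(ler_pM2l (_ : 0 < 2 * pi)) ?mulr_gt0 ?pi_gt0//.
by rewrite mulrCA => /le_trans; apply; rewrite mulrAC divff// mul1r.
Qed.

(** * From the profile to top halves *)

Section radial_profile.
Context {R : realType}.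
Local Open Scope ereal_scope.
Implicit Types (w : plane R -> \bar R) (f : R -> \bar R).

(** A weight is positive and finite at some points arbitrarily close to the
    circle; monotonicity carries this to the whole profile. *)
Lemma annulus_point w (r : R) : weight w -> (0 < r < 1)%R ->
  exists2 z, annulus r 1 z & 0 < w z < +oo.
Proof.
move=> [_ _ [N [mN N0 NP]]] /andP[r0 r1]; apply: contrapT => nz.
have pi1 : (0 < (pi : R) <= pi)%R by rewrite pi_gt0 lexx.
have : (0 < (1 ^+ 2 - r ^+ 2) * wedge (pi : R))%R.
  by rewrite mulr_gt0 ?wedge_gt0// subr_gt0 expr1n expr_lt1// ltW.
rewrite -lte_fin -area_sector_annulus ?(ltW r1)// => /lt_geF/negP; apply.
apply: (@le_trans _ _ (area R N)); last by rewrite N0.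
apply: le_measure; rewrite ?inE//; first exact: measurable_sector_annulus.
move=> z [_ rz]; apply: NP => /= zP; apply: nz; exists z => //.
by apply: zP; case/andP: rz.
Qed.

Lemma cmod_real (r : R) : (0 <= r)%R -> cmod (r, 0%R) = r.
Proof. by move=> r0; rewrite /cmod/= expr0n/= addr0 sqrtr_sqr ger0_norm. Qed.

Lemma increasing_profile_finite w f : weight w -> 0 < w (0%R, 0%R) < +oo ->
  radial_profile w f ->
  (forall r s : R, (0 <= r)%R -> (r <= s)%R -> (s < 1)%R -> f r <= f s) ->
  forall r : R, (0 <= r < 1)%R -> 0 < f r < +oo.
Proof.
move=> hw w0 [_ _ wf] fi r /andP[r0 r1].
have f0 : 0 < f 0%R < +oo by rewrite -(cmod_real (lexx 0)) -wf// /disc/= cmod_real.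
have [->//|rn0] := eqVneq r 0%R.
apply/andP; split; first by case/andP: f0 => /lt_le_trans + _; apply; exact: fi.
have r_gt0 : (0 < r)%R by rewrite lt_neqAle eq_sym rn0.
have [|z /andP[rz z1] /andP[_ zoo]] := @annulus_point w r hw; first by rewrite r_gt0.
by apply: le_lt_trans zoo; rewrite wf//; apply: fi => //; exact: ltW.
Qed.

Lemma decreasing_profile_finite w f : weight w -> 0 < w (0%R, 0%R) < +oo ->
  radial_profile w f ->
  (forall r s : R, (0 <= r)%R -> (r <= s)%R -> (s < 1)%R -> f s <= f r) ->
  forall r : R, (0 <= r < 1)%R -> 0 < f r < +oo.
Proof.
move=> hw w0 [_ _ wf] fd r /andP[r0 r1].
have f0 : 0 < f 0%R < +oo by rewrite -(cmod_real (lexx 0)) -wf// /disc/= cmod_real.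
have [->//|rn0] := eqVneq r 0%R.
apply/andP; split; last by case/andP: f0 => _; apply: le_lt_trans; exact: fd.
have r_gt0 : (0 < r)%R by rewrite lt_neqAle eq_sym rn0.
have [|z /andP[rz z1] /andP[z0 _]] := @annulus_point w r hw; first by rewrite r_gt0.
by apply: (lt_le_trans z0); rewrite wf//; apply: fd => //; exact: ltW.
Qed.

(** All h > 0 are allowed, no bound on the length of an arc being known at this
    point; an arc of infinite length would have an empty top half. *)
Lemma almost_constant_of_profile w (v : R -> R) (C : R) : (1 <= C)%R ->
  (forall z, disc R z -> w z = (v (cmod z))%:E) ->
  (forall h : R, (0 < h)%R -> exists m M : R, (M <= C * m)%R /\
    forall r, (0 < r < 1)%R -> (h / 2 < 1 - r < h)%R -> (m <= v r <= M)%R) ->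
  almost_constant w.
Proof.
move=> C1 wv vP; exists C; split => // I [_ I0].
have [m [M [MC mM]]] : exists m M : R, (M <= C * m)%R /\
    forall z, tophalf I z -> m%:E <= w z <= M%:E.
  case aI : (arclen I) => [h||]; [|by exists 0%R, 0%R; rewrite mulr0; split => // z [] ;
    rewrite aI gt0_muley ?lte_fin ?invr_gt0// ltNge leey|by move: I0; rewrite aI].
  move: I0; rewrite aI lte_fin => /vP [m [M [MC mM]]]; exists m, M; split => // z.
  move=> [z1 /cmod_gt0 z0 _]; rewrite aI -EFinM !lte_fin => h1 h2.
  by rewrite wv// !lee_fin mM ?z0//= h2 andbT mulrC.
apply: (@le_trans _ _ M%:E).
  apply/ess_supP; apply: nearW => z; rewrite /patch; case: ifPn => zI; last exact: leNye.
  by have /andP[] := mM z (set_mem zI).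
apply: (@le_trans _ _ (C%:E * m%:E)); first by rewrite -EFinM lee_fin.
rewrite lee_wpmul2l ?lee_fin ?(le_trans ler01)//.
apply/ess_infP; apply: nearW => z; rewrite /patch; case: ifPn => zI; last exact: leey.
by have /andP[] := mM z (set_mem zI).
Qed.

Lemma increasing_almost_constant w (v : R -> R) :
  (forall z, disc R z -> w z = (v (cmod z))%:E) ->
  (forall r : R, (0 <= r < 1)%R -> (0 < v r)%R) ->
  (forall r s : R, (0 <= r)%R -> (r <= s)%R -> (s < 1)%R -> (v r <= v s)%R) ->
  (exists h0 C : R, [/\ (0 < h0 <= 2^-1)%R, (0 < C)%R &
    forall h : R, (0 < h <= h0)%R -> (v (1 - h / 2) <= C * v (1 - h))%R]) ->
  almost_constant w.
Proof.
move=> wv v0 iv [h0 [C [/andP[h00 h01] C0 H]]].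
have v00 : (0 < v 0)%R by apply: v0; rewrite lexx ltr01.
pose K := Num.max 1%R (Num.max C (v (1 - h0 / 2) / v 0)%R).
have K1 : (1 <= K)%R by rewrite le_max lexx.
have KC : (C <= K)%R by rewrite !le_max lexx orbT.
have Kh : (v (1 - h0 / 2) <= K * v 0)%R by rewrite -ler_pdivrMr// !le_max lexx !orbT.
apply: (almost_constant_of_profile K1 wv) => h h_gt0.
have [hh0|h0h] := leP h h0.
  exists (v (1 - h))%R, (v (1 - h / 2))%R; split.
    apply: le_trans (H h _) _; first by rewrite h_gt0.
    by rewrite ler_wpM2r// ltW// v0//; lra.
  by move=> r r01 hr; rewrite !iv//; lra.
exists (v 0)%R, (v (1 - h0 / 2))%R; split => //.
by move=> r r01 hr; rewrite !iv//; lra.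
Qed.

Lemma decreasing_almost_constant w (v : R -> R) :
  (forall z, disc R z -> w z = (v (cmod z))%:E) ->
  (forall r : R, (0 <= r < 1)%R -> (0 < v r)%R) ->
  (forall r s : R, (0 <= r)%R -> (r <= s)%R -> (s < 1)%R -> (v s <= v r)%R) ->
  (exists h0 C : R, [/\ (0 < h0 <= 2^-1)%R, (0 < C)%R &
    forall h : R, (0 < h <= h0)%R -> (v (1 - h) <= C * v (1 - h / 2))%R]) ->
  almost_constant w.
Proof.
move=> wv v0 dv [h0 [C [/andP[h00 h01] C0 H]]].
have vh0 : (0 < v (1 - h0 / 2))%R by apply: v0; lra.
pose K := Num.max 1%R (Num.max C (v 0 / v (1 - h0 / 2))%R).
have K1 : (1 <= K)%R by rewrite le_max lexx.
have KC : (C <= K)%R by rewrite !le_max lexx orbT.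
have Kh : (v 0 <= K * v (1 - h0 / 2))%R by rewrite -ler_pdivrMr// !le_max lexx !orbT.
apply: (almost_constant_of_profile K1 wv) => h h_gt0.
have [hh0|h0h] := leP h h0.
  exists (v (1 - h / 2))%R, (v (1 - h))%R; split.
    apply: le_trans (H h _) _; first by rewrite h_gt0.
    by rewrite ler_wpM2r// ltW// v0//; lra.
  by move=> r r01 hr; rewrite !dv//; lra.
exists (v (1 - h0 / 2))%R, (v 0)%R; split => //.
by move=> r r01 hr; rewrite !dv//; lra.
Qed.

Lemma real_profile w f : radial_profile w f ->
  (forall r : R, (0 <= r < 1)%R -> 0 < f r < +oo) ->
  [/\ forall r : R, (0 <= r < 1)%R -> f r = (fine (f r))%:E,
      forall r : R, (0 <= r < 1)%R -> (0 < fine (f r))%R,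
      forall z, disc R z -> w z = (fine (f (cmod z)))%:E &
      forall z, disc R z -> 0 < w z < +oo].
Proof.
move=> [_ _ wf] ffin.
have disc_cmod z : disc R z -> (0 <= cmod z < 1)%R by move=> z1; rewrite cmod_ge0.
have fE r : (0 <= r < 1)%R -> f r = (fine (f r))%:E.
  by move=> /ffin /andP[f0 foo]; rewrite fineK// ge0_fin_numE// ltW.
split=> //.
- by move=> r r01; rewrite -lte_fin -fE//; case/andP: (ffin r r01).
- by move=> z zd; rewrite wf// {1}fE// disc_cmod.
- by move=> z zd; rewrite wf//; apply: ffin; exact: disc_cmod.
Qed.

Lemma level_control_of_condition w :
  (forall z, disc R z -> 0 < w z < +oo) ->
  [\/ exists p : R, (1 < p)%R /\ Bp p w, reverse_Hoelder w | reverse_Jensen w] ->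
  level_control w.
Proof.
move=> w_fin [[p [p1 wp]]|wH|wJ].
- exact: (Bp_level_control (proj1 wp) w_fin p1 wp).
- exact: (reverse_Hoelder_level_control (proj1 wH) w_fin wH).
- exact: (reverse_Jensen_level_control (proj1 wJ) w_fin wJ).
Qed.

End radial_profile.

Local Open Scope ereal_scope.

Theorem theorem1p2 (R : realType) (w : plane R -> \bar R)
  (hw : weight w) (hrad : radial w)
  (hw0 : 0 < w (0%R, 0%R) < +oo)
  (hcond :
     (radial_increasing w /\
       [\/ exists p : R, (1 < p)%R /\ Bp p w, reverse_Hoelder w,
           reverse_Jensen w | Binfty w]) \/
     (radial_decreasing w /\
       [\/ exists p : R, (1 < p)%R /\ Bp p w, reverse_Hoelder w |
           reverse_Jensen w])) :
  almost_constant w.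
Proof.
case: hcond => [[[f [wf fi]] hc]|[[f [wf fd]] hc]].
- have [fE v0 wv w_fin] := real_profile wf (increasing_profile_finite hw hw0 wf fi).
  have iv r s : (0 <= r)%R -> (r <= s)%R -> (s < 1)%R -> (fine (f r) <= fine (f s))%R.
    move=> r0 rs s1; rewrite -lee_fin -!fE ?fi//; first by rewrite (le_trans r0).
    by rewrite r0 (le_lt_trans rs).
  apply: (increasing_almost_constant wv v0 iv).
  have increasing_abc := increasing_level_control wv v0 _ iv.
  case: hc => [h|h|h|h]; last exact: (increasing_Binfty wv v0 iv h).
  + by apply/increasing_abc/(level_control_of_condition w_fin); constructor 1.
  + by apply/increasing_abc/(level_control_of_condition w_fin); constructor 2.
  + by apply/increasing_abc/(level_control_of_condition w_fin); constructor 3.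
- have [fE v0 wv w_fin] := real_profile wf (decreasing_profile_finite hw hw0 wf fd).
  have dv r s : (0 <= r)%R -> (r <= s)%R -> (s < 1)%R -> (fine (f s) <= fine (f r))%R.
    move=> r0 rs s1; rewrite -lee_fin -!fE ?fd//; last by rewrite (le_trans r0).
    by rewrite r0 (le_lt_trans rs).
  apply: (decreasing_almost_constant wv v0 dv).
  apply: (decreasing_level_control wv v0 _ dv).
  exact: (level_control_of_condition w_fin hc).
Qed.
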